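(* Let $M$ be a ${\rm II}_1$-factor acting on $H=L^2(M,\tau)$, let $\{z_n\}_{n=1}^\infty\in\mathfrak S$, let $\phi=\sum_{n=1}^\infty \mathrm{Ad}\,Jz_nJ$ and $\tilde\phi=\sum_{n=1}^\infty \mathrm{Ad}\,z_n^*$, and let $P\subseteq M$ be the von Neumann algebra generated by $\{z_n\}_{n=1}^\infty$. If $P$ is a factor, then $$e_P\bigl(B(H)^\phi\cap B(H)^{\tilde\phi}\bigr)e_P=\mathbb C e_P.$$
   Context: $\tau$ is the unique tracial state of $M$, $\xi_0\in H=L^2(M,\tau)$ is the cyclic trace unit vector, and $J$ is the modular conjugation on $H$, $Jx\xi_0=x^*\xi_0$ for $x\in M$. For $a\in B(H)$, $\mathrm{Ad}\,a(T)=aTa^*$. Infinite sums are in the strong operator topology (pointwise for sums of maps). $\mathfrak S$ is the set of sequences $\{z_n\}_{n=1}^\infty$ in $M$ with $\sum_n z_nz_n^*=\sum_n z_n^*z_n=1$ such that for each $n$ there is $k$ with $z_n^*=z_k$. Thus $\phi(T)=\sum_n Jz_nJ\,T\,Jz_n^*J$ and $\tilde\phi(T)=\sum_n z_n^*Tz_n$ are unital normal completely positive maps on $B(H)$. For a map $\theta$ on $B(H)$, $B(H)^\theta=\{T\in B(H):\theta(T)=T\}$. $e_P$ is the orthogonal projection of $H$ onto $L^2(P,\tau)$ (Jones projection). *)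

(* Defs.v *)
From HB Require Import structures.
From mathcomp Require Import all_boot all_order all_algebra.
From mathcomp Require Import complex.
From mathcomp Require Import sesquilinear.
From mathcomp Require Import all_classical all_reals all_analysis.

Set Implicit Arguments.
Unset Strict Implicit.
Unset Printing Implicit Defensive.

Import Order.TTheory GRing.Theory Num.Theory.
Import numFieldNormedType.Exports.

Local Open Scope classical_set_scope.
Local Open Scope ring_scope.
Local Open Scope complex_scope.

Section Operators.
Context (R : realType) (H : completeNormedModType R[i]).
(* Inner product, linear in the first variable. *)
Context (ip : {dot H for (@Num.conj R[i])}).

(* Together with completeness of H, this makes (H, ip) a complex Hilbert
   space. *)
Definition hilbert_norm : Prop := forall u : H, `|u| ^+ 2 = ip u u.

(* B(H), as a set of functions. *)
Definition bounded_ops : set (H -> H) :=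
  [set T : H -> H | linear T /\ continuous T].

(* adjoint T v is the unique w representing the bounded functional
   u |-> <T u, v>; it is only meaningful for T in B(H). *)
Definition adjoint (T : H -> H) (v : H) : H :=
  xget 0 [set w : H | forall u : H, ip (T u) v = ip u w].

(* For a closed subspace K, the orthogonal projection of H onto K. *)
Definition orth_proj (K : set H) (v : H) : H :=
  xget 0 [set w : H | K w /\ forall k : H, K k -> ip (v - w) k = 0].

Definition commutant (A : set (H -> H)) : set (H -> H) :=
  [set T | bounded_ops T /\ forall S, A S -> T \o S = S \o T].

(* Self-adjoint sets of operators equal to their bicommutant; such a set is
   automatically a unital subalgebra of B(H). *)
Definition vN_algebra (M : set (H -> H)) : Prop :=
  [/\ M `<=` bounded_ops,
      forall x, M x -> M (adjoint x)
    & commutant (commutant M) = M].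

Definition vN_generated (A : set (H -> H)) : set (H -> H) :=
  smallest vN_algebra A.

Definition scalar_multiples (e : H -> H) : set (H -> H) :=
  [set c *: e | c in [set: R[i]]].

Definition is_factor (M : set (H -> H)) : Prop :=
  vN_algebra M /\ M `&` commutant M = scalar_multiples idfun.

Definition projection_in (M : set (H -> H)) (e : H -> H) : Prop :=
  [/\ M e, e \o e = e & adjoint e = e].

(* The identity is a finite projection of M. *)
Definition finite_vN (M : set (H -> H)) : Prop :=
  forall u, M u -> adjoint u \o u = idfun -> u \o adjoint u = idfun.

Definition abelian_projection (M : set (H -> H)) (e : H -> H) : Prop :=
  projection_in M e /\
  forall x y, M x -> M y ->
    (e \o x \o e) \o (e \o y \o e) = (e \o y \o e) \o (e \o x \o e).

(* Murray-von Neumann: a finite factor without nonzero abelian projections. *)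
Definition II1_factor (M : set (H -> H)) : Prop :=
  [/\ is_factor M, finite_vN M
    & forall e, abelian_projection M e -> e = (fun=> 0)].

Definition vector_state (xi : H) (x : H -> H) : R[i] := ip (x xi) xi.

(* H is L^2(M, tau) with trace vector xi0: xi0 is a cyclic unit vector whose
   vector state is a tracial state of M (hence is tau, by uniqueness of the
   trace of a II_1 factor). *)
Definition standard_form (M : set (H -> H)) (xi0 : H) : Prop :=
  [/\ `|xi0| = 1,
      closure [set x xi0 | x in M] = [set: H]
    & forall x y, M x -> M y ->
        vector_state xi0 (x \o y) = vector_state xi0 (y \o x)].

(* These conditions determine J uniquely when xi0 is cyclic for M. *)
Definition modular_conj (M : set (H -> H)) (xi0 : H) (J : H -> H) : Prop :=
  [/\ forall u v, J (u + v) = J u + J v,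
      forall (c : R[i]) v, J (c *: v) = Num.conj c *: J v,
      forall v, `|J v| = `|v|
    & forall x, M x -> J (x xi0) = adjoint x xi0].

(* L^2(P, tau) as a closed subspace of L^2(M, tau). *)
Definition L2 (P : set (H -> H)) (xi0 : H) : set H :=
  closure [set x xi0 | x in P].

Definition jones_proj (P : set (H -> H)) (xi0 : H) : H -> H :=
  orth_proj (L2 P xi0).

Definition sot_sum (a : nat -> H -> H) (T : H -> H) : Prop :=
  forall v : H, series (fun n => a n v) @ \oo --> T v.

(* Pointwise strong-operator sum of a sequence of maps on operators. *)
Definition sum_maps (theta : nat -> (H -> H) -> (H -> H))
    (T : H -> H) (v : H) : H :=
  limn (series (fun n => theta n T v)).

Definition Ad (a T : H -> H) : H -> H := a \o T \o adjoint a.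

Definition fixed_ops (theta : (H -> H) -> (H -> H)) : set (H -> H) :=
  [set T | bounded_ops T /\ theta T = T].

(* The set \mathfrak S; sequences are indexed from 0. *)
Definition frakS (M : set (H -> H)) : set (nat -> H -> H) :=
  [set z | [/\ forall n, M (z n),
               sot_sum (fun n => z n \o adjoint (z n)) idfun,
               sot_sum (fun n => adjoint (z n) \o z n) idfun
             & forall n, exists k, adjoint (z n) = z k]].

Definition phi_map (J : H -> H) (z : nat -> H -> H) :=
  sum_maps (fun n => Ad (J \o z n \o J)).

Definition phi_tilde_map (z : nat -> H -> H) :=
  sum_maps (fun n => Ad (adjoint (z n))).

End Operators.

(* Main.v *)
Require Import Defs.
From mathcomp Require Import all_boot all_order all_algebra.
From mathcomp Require Import complex.
From mathcomp Require Import sesquilinear.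
From mathcomp Require Import all_classical all_reals all_analysis.
From mathcomp Require Import ring lra.
From HB Require Import structures.

(* Write [y n = J (z n)^* J], so that [y n xi = z n xi] and the [y]'s commute with the [z]'s,
   and let [T] be fixed by [phi] and [phi_tilde].  Expanding squares and using
   [phi_tilde T = T],
     [sum_n |[z n, T] u|^2 + |T u|^2 = sum_n |T (z n u)|^2].
   Summing this over [u = y_w xi], for all words [w] of length [k], gives
   [sum_n d n k + g k = g k.+1], where [g k] and [d n k] are the sums of [|T y_w xi|^2] and
   of [|[z n, T] y_w xi|^2].  The sequence [g] is bounded and [d n] is nondecreasing (the
   commutator is again fixed by [phi]), hence [d n k = 0]: [T] commutes with the [z]'s on
   [L2 P xi], and by symmetry with the [y]'s.

   The compression [S = e_P T e_P] therefore commutes with [P] and [J P J], and Tomita's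
   argument shows that it commutes with the whole corner [e_P P' e_P].  It follows that
   [x' xi |-> x' S xi], for [x'] in [P'], is bounded; as [xi] is cyclic for [P'], this map
   extends to an operator which commutes with [P'] and [P], and is scalar because [P] is a
   factor. *)

Set Implicit Arguments.
Unset Strict Implicit.
Unset Printing Implicit Defensive.
Import Order.TTheory GRing.Theory Num.Theory.
Import numFieldNormedType.Exports.

Local Open Scope classical_set_scope.
Local Open Scope ring_scope.
Local Open Scope complex_scope.

(** * The real inner product of a complex Hilbert space *)

Section Hilbert.
Context (R : realType) (H : completeNormedModType R[i]).
Context (ip : {dot H for (@Num.conj R[i])}) (hip : hilbert_norm ip).

(** Norms and inner products take values in [R[i]]. Real parts move the estimates into the ordered
    field [R], where [lra] and [nra] apply. *)
Definition rnorm (u : H) : R := complex.Re `|u|.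
Definition rdot (u v : H) : R := complex.Re (ip u v).

Lemma rnormE u : `|u| = (rnorm u)%:C.
Proof.
rewrite /rnorm; have := normr_ge0 u; move: `|u| => [a b].
by rewrite lecE /= => /andP[/eqP -> _].
Qed.

Lemma rnorm_ge0 u : 0 <= rnorm u.
Proof. by have := normr_ge0 u; rewrite rnormE lecR. Qed.

Lemma rnorm0 : rnorm 0 = 0.
Proof. by rewrite /rnorm normr0. Qed.

Lemma rnorm_eq0 u : rnorm u = 0 -> u = 0.
Proof. by move=> h; apply: normr0_eq0; rewrite rnormE h. Qed.

Lemma rnormD u v : rnorm (u + v) <= rnorm u + rnorm v.
Proof. by have := ler_normD u v; rewrite !rnormE -rmorphD lecR. Qed.

Lemma rnormN u : rnorm (- u) = rnorm u.
Proof. by rewrite /rnorm normrN. Qed.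

Lemma ReZ (c : R) (z : R[i]) : complex.Re (c%:C * z) = c * complex.Re z.
Proof. by case: z => a b /=; rewrite mul0r subr0. Qed.

Lemma ipDl u v w : ip (u + v) w = ip u w + ip v w.
Proof. exact: linearDl. Qed.
Lemma ipDr u v w : ip w (u + v) = ip w u + ip w v.
Proof. exact: linearDr. Qed.
Lemma ipZl c u w : ip (c *: u) w = c * ip u w.
Proof. exact: linearZl_LR. Qed.
Lemma ipZr c u w : ip w (c *: u) = Num.conj c * ip w u.
Proof. exact: linearZr_LR. Qed.
Lemma ipC u v : ip u v = Num.conj (ip v u).
Proof. by rewrite hermC expr0 mul1r. Qed.
Lemma ip0l u : ip 0 u = 0.
Proof. exact: linear0l. Qed.
Lemma ip0r u : ip u 0 = 0.
Proof. exact: linear0r. Qed.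

Lemma ipBl u v w : ip (u - v) w = ip u w - ip v w.
Proof. by rewrite ipDl -scaleN1r ipZl mulN1r. Qed.
Lemma ipBr u v w : ip w (u - v) = ip w u - ip w v.
Proof. by rewrite ipDr -scaleN1r ipZr rmorphN1 mulN1r. Qed.

Lemma rdotDl u v w : rdot (u + v) w = rdot u w + rdot v w.
Proof. by rewrite /rdot ipDl raddfD. Qed.
Lemma rdotDr u v w : rdot w (u + v) = rdot w u + rdot w v.
Proof. by rewrite /rdot ipDr raddfD. Qed.
Lemma rdotZl c u w : rdot (c%:C *: u) w = c * rdot u w.
Proof. by rewrite /rdot ipZl ReZ. Qed.
Lemma rdotC u v : rdot u v = rdot v u.
Proof. by rewrite /rdot ipC; case: (ip v u). Qed.
Lemma rdotZr c u w : rdot w (c%:C *: u) = c * rdot w u.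
Proof. by rewrite rdotC rdotZl rdotC. Qed.
Lemma rdotNl u w : rdot (- u) w = - rdot u w.
Proof. by rewrite /rdot linearNl raddfN. Qed.
Lemma rdotNr u w : rdot w (- u) = - rdot w u.
Proof. by rewrite rdotC rdotNl rdotC. Qed.
Lemma rdotBl u v w : rdot (u - v) w = rdot u w - rdot v w.
Proof. by rewrite rdotDl rdotNl. Qed.
Lemma rdotBr u v w : rdot w (u - v) = rdot w u - rdot w v.
Proof. by rewrite rdotDr rdotNr. Qed.
Lemma rdot0l u : rdot 0 u = 0.
Proof. by rewrite /rdot ip0l. Qed.
Lemma rdot0r u : rdot u 0 = 0.
Proof. by rewrite /rdot ip0r. Qed.

Lemma rdot_rnorm u : rdot u u = rnorm u ^+ 2.
Proof. by rewrite /rdot -hip rnormE -rmorphXn. Qed.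

(** The second slot is conjugate-linear, so multiplying [v] by ['i] turns the imaginary part into a
    real part. Orthogonality to a complex subspace can thus be tested with [rdot] alone. *)
Lemma ipE u v : ip u v = (rdot u v +i* rdot u ('i *: v))%C.
Proof.
rewrite /rdot ipZr; case: (ip u v) => a b /=.
by rewrite !(mul0r, mulN1r, oppr0, sub0r, opprK).
Qed.

Lemma rdot_sq u v : rnorm (u + v) ^+ 2 = rnorm u ^+ 2 + 2 * rdot u v + rnorm v ^+ 2.
Proof. by rewrite -!rdot_rnorm rdotDl !rdotDr (rdotC v u); ring. Qed.

Lemma rdot_sqB u v : rnorm (u - v) ^+ 2 = rnorm u ^+ 2 - 2 * rdot u v + rnorm v ^+ 2.
Proof. by rewrite rdot_sq rdotNr rnormN; ring. Qed.

Lemma rnormZ (c : R) u : rnorm (c%:C *: u) = `|c| * rnorm u.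
Proof.
apply/eqP; rewrite -(@eqrXn2 _ 2) ?mulr_ge0 ?rnorm_ge0 //.
by rewrite -rdot_rnorm rdotZl rdotZr rdot_rnorm exprMn real_normK ?num_real // mulrA expr2.
Qed.

Lemma rnormZC (c : R[i]) u : rnorm (c *: u) = complex.Re `|c| * rnorm u.
Proof.
rewrite /rnorm normrZ; have -> : `|c| = (complex.Re `|c|)%:C.
  by rewrite normc_def.
by rewrite rnormE ReZ.
Qed.

Lemma rdot_le u v : rdot u v <= rnorm u * rnorm v.
Proof.
have [->|u0] := eqVneq u 0; first by rewrite rdot0l rnorm0 mul0r.
have [->|v0] := eqVneq v 0; first by rewrite rdot0r rnorm0 mulr0.
have pu : 0 < rnorm u by rewrite lt_def rnorm_ge0 andbT; apply: contraNneq u0 => /rnorm_eq0 ->.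
have pv : 0 < rnorm v by rewrite lt_def rnorm_ge0 andbT; apply: contraNneq v0 => /rnorm_eq0 ->.
(* Cauchy-Schwarz: this square expands to [2 |u| |v| (|u| |v| - rdot u v)]. *)
have := exprn_ge0 2 (rnorm_ge0 ((rnorm v)%:C *: u - (rnorm u)%:C *: v)).
rewrite rdot_sqB rdotZl rdotZr !rnormZ !ger0_norm ?rnorm_ge0 //.
move=> h.
have {h} : 0 <= (rnorm u * rnorm v) * (rnorm u * rnorm v - rdot u v) by nra.
by rewrite pmulr_rge0 ?subr_ge0 // mulr_gt0.
Qed.

Lemma rdot_abs u v : `|rdot u v| <= rnorm u * rnorm v.
Proof.
rewrite ler_norml rdot_le andbT lerNl.
by rewrite -rdotNl -(rnormN u) rdot_le.
Qed.

Lemma rdot_eqr u v : (forall w, rdot w u = rdot w v) -> u = v.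
Proof.
move=> h; apply/eqP; rewrite -subr_eq0; apply/eqP/rnorm_eq0/eqP.
by rewrite -sqrf_eq0 -rdot_rnorm rdotBr h subrr.
Qed.

Lemma ip_eqr u v : (forall w, ip w u = ip w v) -> u = v.
Proof. by move=> h; apply: rdot_eqr => w; rewrite /rdot h. Qed.

Lemma rnormB u v : rnorm (u - v) = rnorm (v - u).
Proof. by rewrite -rnormN opprB. Qed.

Lemma rnorm_tri w u v : rnorm (u - v) <= rnorm (u - w) + rnorm (w - v).
Proof. by rewrite -[u - v](subrKA w) rnormD. Qed.

End Hilbert.

(** * Convergence and bounded operators *)

Section Topology.
Context (R : realType) (H : completeNormedModType R[i]).
Context (ip : {dot H for (@Num.conj R[i])}) (hip : hilbert_norm ip).
Implicit Types (u v w : H) (T : H -> H).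

Lemma posC (e : R[i]) : 0 < e -> exists2 d : R, 0 < d & e = d%:C.
Proof. by move: e => [a b]; rewrite ltcE /= => /andP[/eqP -> a0]; exists a. Qed.

Lemma cvg_rnorm (a : nat -> H) l : a @ \oo --> l <->
  forall e : R, 0 < e -> exists N, forall n, (N <= n)%N -> rnorm (l - a n) < e.
Proof.
split=> [/cvgrPdist_lt h e e0|h].
  have e0' : 0 < e%:C by rewrite ltcR.
  have [N _ hN] := h _ e0'; exists N => n Nn.
  by have := hN n Nn; rewrite /= rnormE ltcR.
apply/cvgrPdist_lt => _ /posC[d d0 ->]; have [N hN] := h d d0.
by exists N => // n Nn /=; rewrite rnormE ltcR hN.
Qed.

Lemma rnorm_complete (a : nat -> H) :
  (forall e : R, 0 < e -> exists N, forall m n, (N <= m)%N -> (N <= n)%N ->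
     rnorm (a m - a n) < e) -> exists l : H, a @ \oo --> l.
Proof.
move=> h; suff : cvgn a by move=> ?; exists (lim (a @ \oo) : H).
apply: cauchy_cvg; apply: cauchy_exP => _ /posC[d d0 ->].
have [N hN] := h d d0; exists (a N); exists N => // n Nn /=.
by rewrite -ball_normE /= rnormE ltcR hN.
Qed.

Lemma closureP (A : set H) v :
  closure A v <-> forall e : R, 0 < e -> exists2 a, A a & rnorm (v - a) < e.
Proof.
split=> [h e e0|h B /nbhs_ballP[_ /= /posC[d d0 ->] dB]].
  have e0' : 0 < e%:C by rewrite ltcR.
  have [a [Aa]] := h _ (nbhsx_ballx v _ e0').
  by rewrite -ball_normE /= rnormE ltcR; exists a.
have [a Aa va] := h d d0; exists a; split=> //; apply: dB.
by rewrite -ball_normE /= rnormE ltcR.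
Qed.

Section OneOp.
Context (T : H -> H) (bT : bounded_ops T).
Lemma bopP c u v : T (c *: u + v) = c *: T u + T v.
Proof. by case: bT => h _; rewrite h. Qed.
Lemma bopD u v : T (u + v) = T u + T v.
Proof. by have := bopP 1 u v; rewrite !scale1r. Qed.
Lemma bop0 : T 0 = 0.
Proof.
have := bopD 0 0; rewrite addr0 => /eqP.
by rewrite -subr_eq0 opprD addNKr oppr_eq0 => /eqP.
Qed.
Lemma bopZ c u : T (c *: u) = c *: T u.
Proof. by have := bopP c u 0; rewrite bop0 !addr0. Qed.
Lemma bopN u : T (- u) = - T u.
Proof. by rewrite -scaleN1r bopZ scaleN1r. Qed.
Lemma bopB u v : T (u - v) = T u - T v.
Proof. by rewrite bopD bopN. Qed.

Lemma bop_bound : exists2 C : R, 0 <= C & forall u, rnorm (T u) <= C * rnorm u.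
Proof.
case: bT => lT cT.
pose f : {linear H -> H} := HB.pack T (GRing.isLinear.Build _ _ _ _ T lT).
have /linear_boundedP [M [Mr hM]] : bounded_near f (nbhs 0).
  by apply/linear_bounded_continuous.
exists (complex.Re (`|M| + 1)).
  have := normr_ge0 M; move: `|M| => [a b]; rewrite lecE /= => /andP[_ a0].
  by rewrite addr_ge0.
move=> u; have /hM /(_ u) : M < `|M| + 1.
  by rewrite (le_lt_trans (real_ler_norm Mr)) // ltrDl.
rewrite /= !rnormE.
have -> : `|M| + 1 = (complex.Re (`|M| + 1))%:C.
  have := normr_ge0 M; move: `|M| => [a b]; rewrite lecE /= => /andP[/eqP-> _].
  by apply/eqP; rewrite eq_complex /= addr0 !eqxx.
by rewrite -rmorphM lecR.
Qed.
End OneOp.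

Lemma bounded_opsP T (C : R) : linear T -> (forall u, rnorm (T u) <= C * rnorm u) ->
  bounded_ops T.
Proof.
move=> lT hC; split=> //.
pose f : {linear H -> H} := HB.pack T (GRing.isLinear.Build _ _ _ _ T lT).
suff : continuous f by [].
apply/linear_bounded_continuous/linear_boundedP.
exists C%:C; split; first by rewrite complex_real.
move=> M CM u; rewrite !rnormE.
apply: (@le_trans _ _ (C%:C * (rnorm u)%:C)); first by rewrite -rmorphM lecR.
by rewrite ler_wpM2r ?lecR ?rnorm_ge0 // ltW.
Qed.


Lemma bop_id : bounded_ops (idfun : H -> H).
Proof. by apply: (@bounded_opsP _ 1) => // u; rewrite mul1r. Qed.

Lemma bop_comp S T : bounded_ops S -> bounded_ops T -> bounded_ops (S \o T).
Proof.
move=> bS bT; have [C C0 hC] := bop_bound bS; have [D D0 hD] := bop_bound bT.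
apply: (@bounded_opsP _ (C * D)) => [c u v|u] /=; first by rewrite !bopP.
by rewrite (le_trans (hC _)) // -mulrA ler_wpM2l.
Qed.

Lemma bop_sub S T : bounded_ops S -> bounded_ops T -> bounded_ops (fun u => S u - T u).
Proof.
move=> bS bT; have [C C0 hC] := bop_bound bS; have [D D0 hD] := bop_bound bT.
apply: (@bounded_opsP _ (C + D)) => [c u v|u] /=.
  by rewrite (bopP bS) (bopP bT) scalerBr opprD addrACA.
by rewrite (le_trans (rnormD _ _)) // rnormN mulrDl lerD.
Qed.

Lemma bop_scale c : bounded_ops (fun u : H => c *: u).
Proof.
apply: (@bounded_opsP _ (complex.Re `|c|)) => [d u v|u]; last by rewrite rnormZC.
by rewrite scalerDr !scalerA mulrC.
Qed.

Lemma rnorm_small u (C : R) : (forall e : R, 0 < e -> rnorm u <= C * e) -> u = 0.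
Proof.
move=> h; apply: rnorm_eq0; apply/eqP; rewrite eq_le rnorm_ge0 andbT.
apply/ler_addgt0Pl => e e0; rewrite addr0.
have C1 : 0 < `|C| + 1 by rewrite ltr_wpDl.
rewrite (le_trans (h (e / (`|C| + 1)) _)) ?divr_gt0 //.
rewrite mulrCA ger_pMr // ler_pdivrMr // mul1r.
by rewrite (le_trans (ler_norm C)) // lerDl.
Qed.

(** Cantor's intersection theorem: points chosen in the [E n] form a Cauchy sequence. The [E n] are
    not assumed closed, so the limit is only placed in their closures. It serves both for minimising
    sequences and for extension by density. *)
Lemma complete_nested (E : nat -> set H) :
  (forall n, E n !=set0) -> (forall m n, (m <= n)%N -> E n `<=` E m) ->
  (forall e : R, 0 < e -> exists n, forall u v, E n u -> E n v -> rnorm (u - v) < e) ->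
  exists w, forall n, closure (E n) w.
Proof.
move=> /choice[a aE] Em hE; have [|l /cvg_rnorm hl] := @rnorm_complete a.
  move=> e /hE[N hN]; exists N => m n Nm Nn.
  by apply: hN; [apply: Em Nm _ _|apply: Em Nn _ _].
exists l => n; apply/closureP => e /hl[N hN]; exists (a (maxn n N)).
  by apply: Em (aE _); exact: leq_maxl.
by rewrite hN // leq_maxr.
Qed.

End Topology.

(** * Orthogonal projections and adjoints *)

Section Projection.
Context (R : realType) (H : completeNormedModType R[i]).
Context (ip : {dot H for (@Num.conj R[i])}) (hip : hilbert_norm ip).
Implicit Types (u v w : H) (T : H -> H) (K : set H).
Local Notation rip := (rdot ip).

Definition closed_subspace (K : set H) : Prop :=
  [/\ K 0, forall c u v, K u -> K v -> K (c *: u + v) & closure K `<=` K].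

Section Subspace.
Context (K : set H) (hK : closed_subspace K).
Lemma csP c u v : K u -> K v -> K (c *: u + v). Proof. by case: hK => _ + _; apply. Qed.
Lemma cs0 : K 0. Proof. by case: hK. Qed.
Lemma csZ c u : K u -> K (c *: u).
Proof. by move=> Ku; rewrite -[_ *: _]addr0; apply: csP => //; exact: cs0. Qed.
Lemma csD u v : K u -> K v -> K (u + v).
Proof. by move=> Ku Kv; rewrite -[u]scale1r; exact: csP. Qed.
Lemma csN u : K u -> K (- u).
Proof. by move=> Ku; rewrite -scaleN1r; exact: csZ. Qed.
Lemma csB u v : K u -> K v -> K (u - v).
Proof. by move=> Ku Kv; apply: csD => //; exact: csN. Qed.

Lemma rdot0_ip0 u : (forall k, K k -> rip u k = 0) -> forall k, K k -> ip u k = 0.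
Proof. by move=> h k Kk; rewrite ipE !h //; exact: csZ. Qed.

(** The squared distance [f] to [v] is minimised over [K]: the sets [E n] of near-minimisers shrink
    by the parallelogram law, and their limit [w] satisfies the first-order condition of a
    minimum. *)
Lemma orth_proj_exists v : exists w, K w /\ forall k, K k -> ip (v - w) k = 0.
Proof.
pose f k := rnorm (v - k) ^+ 2; pose A := [set f k | k in K].
have lbA : has_inf A.
  split; first by exists (f 0); exists 0 => //; exact: cs0.
  by exists 0 => _ [k _ <-]; rewrite exprn_ge0 ?rnorm_ge0.
pose d := inf A.
have dle k : K k -> d <= f k by move=> Kk; apply: ge_inf; [case: lbA|exists k].
pose E n := [set k | K k /\ f k < d + n.+1%:R^-1].
have inv_small (e : R) : 0 < e -> exists n, n.+1%:R^-1 < e.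
  move=> e0; exists (Num.bound e^-1); rewrite invf_plt ?posrE //.
  by rewrite (lt_trans (archi_boundP _)) ?ltr_nat // invr_ge0 ltW.
have [| | |w hw] := @complete_nested _ _ E.
- move=> n; have n0 : 0 < n.+1%:R^-1 :> R by rewrite invr_gt0.
  have [_ [k Kk <-] hk] := inf_adherent n0 lbA.
  by exists k.
- move=> m n mn k [Kk hk]; split=> //; rewrite (lt_le_trans hk) // lerD2l.
  by rewrite lef_pV2 ?posrE // ler_nat.
(* The midpoint of [x] and [y] lies in [K], so [f] is at least [d] there, and the parallelogram law
   yields [|x - y|^2 < 4 / n.+1]. This explains the threshold [e ^+ 2 / 4]. *)
- move=> e e0; have [n hn] := inv_small (e ^+ 2 / 4) (ltac:(by rewrite divr_gt0 ?exprn_gt0)).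
  exists n => x y [Kx hx] [Ky hy].
  have hm : d <= f ((2^-1)%:C *: (x + y)) by apply: dle; apply: csZ; exact: csD.
  rewrite -(@ltr_pXn2r _ 2) ?nnegrE ?rnorm_ge0 ?(ltW e0) //.
  have e1 : v - x + (v - y) = 2%:C *: (v - (2^-1)%:C *: (x + y)).
    rewrite scalerBr scalerA -rmorphM mulfV // scale1r.
    have -> : 2%:C = 1 + 1 :> R[i] by rewrite -rmorphD.
    by rewrite scalerDl scale1r addrACA opprD.
  have := rdot_sq hip (v - x) (v - y); have := rdot_sqB hip (v - x) (v - y).
  rewrite e1 (rnormZ hip) exprMn real_normK ?num_real // opprB addrC subrKA (rnormB y).
  move: hx hy hm hn; rewrite /f; set p := rip _ _.
  set a := rnorm _ ^+ 2; set b := rnorm _ ^+ 2.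
  set c := rnorm _ ^+ 2; set q := rnorm _ ^+ 2; set g := _^-1.
  move=> *; nra.
exists w; split.
  case: hK => _ _; apply; apply/closureP => e e0.
  by have /closureP/(_ e e0)[a [Ka _] ?] := hw 0%N; exists a.
apply: rdot0_ip0.
(* Applied to [k] and to [- k], the one-sided bound gives equality. *)
suff hle k : K k -> rip (v - w) k <= 0.
  move=> k Kk; apply/eqP; rewrite eq_le hle // -oppr_le0 -rdotNr hle //; exact: csN.
move=> Kk; set N := rnorm k ^+ 2.
have N0 : 0 <= N by rewrite exprn_ge0 ?rnorm_ge0.
(* Take [x] in [K] within [t] of [w] with [f x < d + t^2]. Comparing [d] with [f (x + t k)] gives
   [2 rip (v - x) k <= t (1 + N)], and replacing [x] by [w] costs at most [t |k|]. *)
have key t : 0 < t -> rip (v - w) k <= t * ((1 + N) / 2 + rnorm k).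
  move=> t0; have [n hn] := inv_small (t ^+ 2) (ltac:(by rewrite exprn_gt0)).
  have /closureP/(_ t t0)[x [Kx hx] wx] := hw n.
  have := dle _ (csD Kx (csZ t%:C Kk)).
  rewrite /f opprD addrA (rdot_sqB hip) rdotZr (rnormZ hip) exprMn real_normK ?num_real //.
  rewrite -/(f x) -/N => h1.
  have h2 : rip (v - x) k <= t * ((1 + N) / 2).
    rewrite -(ler_pM2l t0).
    move: hx hn h1; move: (f x) (_^-1) (rip _ _) => F g r.
    clearbody d N; move=> *; nra.
  have -> : v - w = (v - x) - (w - x) by rewrite opprB addrA subrK.
  rewrite rdotBl mulrDr lerD // -rdotNl (le_trans (rdot_le hip _ _)) // rnormN.
  by rewrite ler_wpM2r ?rnorm_ge0 // ltW.
apply/ler_addgt0Pl => e e0; rewrite addr0.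
set C := _ + rnorm k in key; have C0 : 0 < C.
  by rewrite ltr_wpDr ?rnorm_ge0 // divr_gt0 // ltr_wpDr.
by rewrite (le_trans (key (e / C) _)) ?divr_gt0 // divfK // gt_eqF.
Qed.

Local Notation p := (orth_proj ip K).

Lemma orth_projP v : K (p v) /\ forall k, K k -> ip (v - p v) k = 0.
Proof. exact: xgetPex (orth_proj_exists v). Qed.

Lemma orth_proj_in v : K (p v). Proof. by have [] := orth_projP v. Qed.

Lemma orth_proj_orth v k : K k -> ip (p v) k = ip v k.
Proof.
have [_ h] := orth_projP v => /h; rewrite ipBl => /eqP.
by rewrite subr_eq0 => /eqP.
Qed.

Lemma orth_proj_eq v w : K w -> (forall k, K k -> ip w k = ip v k) -> p v = w.
Proof.
move=> Kw h; apply/eqP; rewrite -subr_eq0; apply/eqP/rnorm_eq0/eqP.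
have Kd := csB (orth_proj_in v) Kw.
by rewrite -sqrf_eq0 -(rdot_rnorm hip) /rdot ipBl orth_proj_orth // h // subrr.
Qed.

Lemma orth_proj_id v : K v -> p v = v.
Proof. by move=> Kv; exact: orth_proj_eq. Qed.

Lemma orth_proj_idem v : p (p v) = p v.
Proof. exact/orth_proj_id/orth_proj_in. Qed.

Lemma orth_proj_sym u v : ip (p u) v = ip u (p v).
Proof.
rewrite (ipC ip _ v) -(orth_proj_orth v (orth_proj_in u)) -ipC.
by rewrite (orth_proj_orth u (orth_proj_in v)).
Qed.

Lemma orth_proj_bop : bounded_ops p.
Proof.
apply: (@bounded_opsP _ _ _ 1) => [c u v|u].
  apply: orth_proj_eq => [|k Kk]; first by apply: csP; exact: orth_proj_in.
  by rewrite !(ipDl, ipZl) !orth_proj_orth.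
rewrite mul1r.
have : rip (p u) (p u) <= rnorm (p u) * rnorm u.
  rewrite {1}/rdot -{1}orth_proj_sym orth_proj_idem.
  exact: rdot_le.
rewrite (rdot_rnorm hip) expr2.
have [->|p0] := eqVneq (rnorm (p u)) 0; first by rewrite rnorm_ge0.
by rewrite ler_pM2l // lt_def p0 rnorm_ge0.
Qed.
End Subspace.

(** This makes the [xget] in [adjoint] meaningful. The functional [u |-> ip (T u) v] has a closed
    kernel [K]. If [K] is not everything, some nonzero [e] is orthogonal to [K], and pairing
    [ip (T e) v *: u - ip (T u) v *: e], an element of [K], with [e] exhibits the representing
    vector as a multiple of [e]. *)
Lemma riesz T v : bounded_ops T -> exists w, forall u, ip (T u) v = ip u w.
Proof.
move=> bT; pose K := [set u | ip (T u) v = 0].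
have hK : closed_subspace K.
  split; rewrite /K /=.
  - by rewrite (bop0 bT) ip0l.
  - by move=> c x y Kx Ky; rewrite (bopP bT) ipDl ipZl Kx Ky mulr0 addr0.
  - move=> u /closureP cu; have [C C0 hC] := bop_bound bT.
    have e0 c : `|rip (T u) (c *: v)| <= 0.
      apply/ler_addgt0Pl => e e0; rewrite addr0.
      set B := C * rnorm (c *: v).
      have B1 : 0 < B + 1 by rewrite ltr_wpDl // mulr_ge0 ?rnorm_ge0.
      have [a Ka ua] := cu (e / (B + 1)) (divr_gt0 e0 B1).
      have -> : rip (T u) (c *: v) = rip (T (u - a)) (c *: v).
        by rewrite (bopB bT) rdotBl {3}/rdot ipZr Ka mulr0 subr0.
      rewrite (le_trans (rdot_abs hip _ _)) // (le_trans (ler_wpM2r (rnorm_ge0 _) (hC _))) //.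
      rewrite mulrAC -/B (le_trans (ler_wpM2l _ (ltW ua))) ?mulr_ge0 ?rnorm_ge0 //.
      by rewrite mulrCA ger_pMr // ler_pdivrMr // mul1r lerDl.
    rewrite /= ipE; have := e0 1; have := e0 'i; rewrite scale1r !normr_le0.
    by move=> /eqP -> /eqP ->.
have [allK|/existsNP[u0 nu0]] := pselect (forall u, K u).
  by exists 0 => u; rewrite ip0r; exact: allK.
pose e := u0 - orth_proj ip K u0.
have eK k : K k -> ip k e = 0.
  by move=> Kk; rewrite ipC (orth_projP hK u0).2 // conjC0.
have e0 : ip e e != 0.
  apply: contra_notN nu0; rewrite -hip sqrf_eq0 normr_eq0 subr_eq0 => /eqP ->.
  exact: orth_proj_in.
exists (Num.conj (ip (T e) v / ip e e) *: e) => u.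
have : K (ip (T e) v *: u - ip (T u) v *: e).
  by rewrite /K /= (bopB bT) !(bopZ bT) ipBl !ipZl mulrC subrr.
move=> /eK; rewrite ipBl !ipZl => /eqP; rewrite subr_eq0 => /eqP h.
by rewrite ipZr conjCK mulrAC h mulfK.
Qed.

Section Adjoint.
Context (T : H -> H) (bT : bounded_ops T).
Local Notation adj := (adjoint ip).

Lemma adjP u v : ip (T u) v = ip u ((adj T) v).
Proof. exact: (xgetPex 0 (riesz v bT)). Qed.

Lemma adjPr u v : ip u (T v) = ip ((adj T) u) v.
Proof. by rewrite ipC adjP -ipC. Qed.

Lemma adj_eq S : (forall u v, ip (T u) v = ip u (S v)) -> (adj T) = S.
Proof. by move=> h; apply/funext => v; apply: (ip_eqr hip) => u; rewrite -adjP h. Qed.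

Lemma adj_bop : bounded_ops (adj T).
Proof.
have [C C0 hC] := bop_bound bT.
apply: (@bounded_opsP _ _ _ C) => [c u v|u].
  by apply: (ip_eqr hip) => w; rewrite -adjP !ipDr !ipZr -!adjP.
have : rip ((adj T) u) ((adj T) u) <= C * rnorm ((adj T) u) * rnorm u.
  rewrite {1}/rdot -adjP (le_trans (rdot_le hip _ _)) //.
  by rewrite ler_wpM2r ?rnorm_ge0.
rewrite (rdot_rnorm hip) mulrAC expr2.
have [->|p0] := eqVneq (rnorm ((adj T) u)) 0; first by rewrite mulr_ge0 ?rnorm_ge0.
by rewrite ler_pM2r // lt_def p0 rnorm_ge0.
Qed.
End Adjoint.

Lemma adjK T : bounded_ops T -> adjoint ip (adjoint ip T) = T.
Proof.
by move=> bT; apply: (adj_eq (adj_bop bT)) => u v; rewrite (adjPr bT).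
Qed.

Lemma adj_comp S T : bounded_ops S -> bounded_ops T ->
  adjoint ip (S \o T) = adjoint ip T \o adjoint ip S.
Proof.
by move=> bS bT; apply: (adj_eq (bop_comp bS bT)) => u v /=; rewrite (adjP bS) (adjP bT).
Qed.

End Projection.

(** * Harmonic operators *)

Section Transfer.
Context (R : realType).
Local Open Scope ereal_scope.

Lemma nneseries_EFin (f : nat -> R) l : series f @ \oo --> l ->
  \sum_(0 <= n <oo) (f n)%:E = l%:E.
Proof.
move=> fl; apply/cvg_lim => //.
have -> : (fun n => \sum_(0 <= k < n) (f k)%:E) = EFin \o series f.
  by apply/funext => n; rewrite /= /series /= sumEFin.
by apply: cvg_EFin => //; exact: nearW.
Qed.

Context (H : Type) (b : nat -> H -> H).

(** The iterate [iter k transfer h u] is the sum of [h] over all [b_w u], with [w] a word of length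
    [k]. Values in [\bar R] let nonnegative double sums be interchanged before any finiteness is
    known. *)
Definition transfer (h : H -> \bar R) (u : H) : \bar R :=
  \sum_(0 <= n <oo) h (b n u).

Lemma iter_transfer_ge0 k h : (forall u, 0 <= h u) -> forall u, 0 <= iter k transfer h u.
Proof. by move=> h0; elim: k => //= k ih u; apply: nneseries_ge0. Qed.

Lemma iter_transfer_le k h1 h2 : (forall u, 0 <= h1 u) -> (forall u, h1 u <= h2 u) ->
  forall u, iter k transfer h1 u <= iter k transfer h2 u.
Proof.
move=> h0 h12; elim: k => //= k ih u.
by apply: lee_nneseries => // n _ _; exact: iter_transfer_ge0.
Qed.

Lemma iter_transferD k h1 h2 : (forall u, 0 <= h1 u) -> (forall u, 0 <= h2 u) ->
  forall u, iter k transfer (fun u => h1 u + h2 u) u =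
    iter k transfer h1 u + iter k transfer h2 u.
Proof.
move=> h10 h20; elim: k => //= k ih u.
rewrite /transfer -nneseriesD; [|by move=> ? _ _; exact: iter_transfer_ge0..].
by apply: eq_eseriesr => n _; exact: ih.
Qed.

Lemma iter_transfer_sum k (h : nat -> H -> \bar R) : (forall n u, 0 <= h n u) ->
  forall u, iter k transfer (fun u => \sum_(0 <= n <oo) h n u) u =
    \sum_(0 <= n <oo) iter k transfer (h n) u.
Proof.
move=> h0; elim: k => //= k ih u.
rewrite /transfer [RHS]nneseries_interchange; last by move=> *; exact: iter_transfer_ge0.
by apply: eq_eseriesr => n _; exact: ih.
Qed.

Lemma iter_transfer_comm k (a : H -> H) h : (forall n u, b n (a u) = a (b n u)) ->
  forall u, iter k transfer (h \o a) u = iter k transfer h (a u).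
Proof.
move=> ab; elim: k => //= k ih u.
by apply: eq_eseriesr => n _; rewrite ih ab.
Qed.

Lemma iter_transfer_eq0 k h u : (forall u, 0 <= h u) -> iter k transfer h u = 0 ->
  forall w, size w = k -> h (foldl (fun v m => b m v) u w) = 0.
Proof.
move=> h0; elim: k u => [u hu [|//] _ //|k ih u /= hu [//|m w] /= [sw]].
apply: ih => //; apply/eqP; rewrite eq_le iter_transfer_ge0 // andbT -hu.
rewrite /transfer (@nneseriesD1 _ _ m) //; last by move=> *; exact: iter_transfer_ge0.
by rewrite leeDl // nneseries_ge0 // => *; exact: iter_transfer_ge0.
Qed.

End Transfer.

(** * Squared commutators of harmonic operators *)

Section Harmonic.
Context (R : realType) (H : completeNormedModType R[i]).
Context (ip : {dot H for (@Num.conj R[i])}) (hip : hilbert_norm ip).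
Local Notation rip := (rdot ip).
Implicit Types (a b : nat -> H -> H) (T : H -> H).

(* [T = \sum_n (a n)^* T (a n)] in the weak operator topology. *)
Definition wot_harmonic a T : Prop := forall u v,
  series (fun n => rip (T (a n u)) (a n v)) @ \oo --> rip (T u) v.

Definition column_isometry a : Prop := forall u,
  series (fun n => rnorm (a n u) ^+ 2) @ \oo --> rnorm u ^+ 2.

Definition sqnorm T (u : H) : \bar R := (rnorm (T u) ^+ 2)%:E.

Definition commutator (S T : H -> H) (u : H) := S (T u) - T (S u).

Lemma sqnorm_ge0 T u : (0 <= sqnorm T u)%E.
Proof. by rewrite lee_fin sqr_ge0. Qed.

Lemma series_ge0_nondecreasing (f : nat -> R) : (forall n, 0 <= f n) ->
  {homo series f : n m / (n <= m)%N >-> n <= m}.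
Proof.
move=> f0; apply/nondecreasing_seqP => n.
by rewrite /series /= big_nat_recr //= lerDl.
Qed.

Lemma series_ge0_le_lim (f : nat -> R) l N : (forall n, 0 <= f n) ->
  series f @ \oo --> l -> series f N <= l.
Proof.
move=> f0 fl; have <- := cvg_lim (@Rhausdorff R) fl.
by apply: nondecreasing_cvgn_le; [exact: series_ge0_nondecreasing|exact: cvgP fl].
Qed.

Lemma sum_sqnorm_bound a T (C : R) : (forall u, rnorm (T u) <= C * rnorm u) -> 
  column_isometry a -> forall u N,
  series (fun n => rnorm (T (a n u)) ^+ 2) N <= C ^+ 2 * rnorm u ^+ 2.
Proof.
move=> hC ha u N; apply: (@le_trans _ _ (C ^+ 2 * series (fun n => rnorm (a n u) ^+ 2) N)).
  rewrite /series /= mulr_sumr ler_sum // => n _.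
  by rewrite -exprMn lerXn2r ?nnegrE ?rnorm_ge0 // (le_trans _ (hC _)) ?rnorm_ge0.
rewrite ler_wpM2l ?sqr_ge0 //; apply: series_ge0_le_lim (ha u) => n.
exact: sqr_ge0.
Qed.

(** In the expansion of [|a_n T u - T a_n u|^2], the first squares sum to [|T u|^2] by isometry and
    the cross terms to [-2 |T u|^2] by harmonicity tested against [T u]. The squares [|T a_n u|^2]
    remain; their partial sums are bounded, hence convergent. *)
Lemma harmonic_commutator a T : bounded_ops T -> column_isometry a ->
  wot_harmonic a T -> forall u,
  (\sum_(0 <= n <oo) sqnorm (commutator (a n) T) u + sqnorm T u =
   \sum_(0 <= n <oo) sqnorm T (a n u))%E.
Proof.
move=> bT ha hT u; have [C C0 hC] := bop_bound bT.
pose q := series (fun n => rnorm (T (a n u)) ^+ 2).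
have cq : cvgn q.
  apply: nondecreasing_is_cvgn.
    by apply: series_ge0_nondecreasing => n; exact: sqr_ge0.
  by exists (C ^+ 2 * rnorm u ^+ 2) => _ [n _ <-]; exact: (sum_sqnorm_bound hC ha).
have h1 := ha (T u); have h2 := hT u (T u).
rewrite [RHS](nneseries_EFin (l := limn q)) //.
rewrite (nneseries_EFin (l := rnorm (T u) ^+ 2 - 2 * rip (T u) (T u) + limn q)).
  by rewrite -EFinD (rdot_rnorm hip); congr EFin; ring.
have -> : series (fun n => rnorm (commutator (a n) T u) ^+ 2) =
   (fun n => series (fun n => rnorm (a n (T u)) ^+ 2) n
     - 2 * series (fun n => rip (T (a n u)) (a n (T u))) n + q n).
  apply/funext => N; rewrite /q /series /= mulr_sumr -sumrB -big_split /=.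
  by apply: eq_bigr => n _; rewrite (rdot_sqB hip) (rdotC _ (T _)).
apply: cvgD cq; apply: (cvgB h1); apply: cvgM h2; exact: cvg_cst.
Qed.

(** The two families enter abstractly so that the result can be used twice, with the [z]'s and [y]'s
    exchanged. Each letter of a word acts on [xi] from the [b] side, while the commutator is taken
    with the [a] side. *)
Lemma harmonic_commutator_eq0 a b T xi :
  (forall n, bounded_ops (a n)) -> (forall n, bounded_ops (b n)) -> bounded_ops T ->
  column_isometry a -> column_isometry b ->
  (forall n m u, a n (b m u) = b m (a n u)) ->
  (forall n m u, adjoint ip (a n) (b m u) = b m (adjoint ip (a n) u)) ->
  (forall n, a n xi = b n xi) ->
  wot_harmonic a T -> wot_harmonic b T ->
  forall n w, commutator (a n) T (foldl (fun v m => b m v) xi w) = 0.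
Proof.
move=> ba bb bT ia ib ab a'b abxi hTa hTb n w.
pose L := transfer (R := R) b.
have bD m : bounded_ops (commutator (a m) T).
  by apply: bop_sub; apply: bop_comp.
(* Moving [a m] onto [v] as its adjoint, which commutes with the [b]'s, reduces the claim to two
   instances of harmonicity of [T]. *)
have hD m : wot_harmonic b (commutator (a m) T).
  move=> u v.
  have -> : (fun k => rip (commutator (a m) T (b k u)) (b k v)) =
    (fun k => rip (T (b k u)) (b k (adjoint ip (a m) v)) - rip (T (b k (a m u))) (b k v)).
    apply/funext => k; rewrite /commutator rdotBl ab; congr (_ - _).
    by rewrite /rdot (adjP hip (ba m)) a'b.
  have -> : rip (commutator (a m) T u) v = rip (T u) (adjoint ip (a m) v) - rip (T (a m u)) v.
    by rewrite /commutator rdotBl {1}/rdot (adjP hip (ba m)).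
  have -> : series (fun k => rip (T (b k u)) (b k (adjoint ip (a m) v)) -
       rip (T (b k (a m u))) (b k v)) =
   (fun N => series (fun k => rip (T (b k u)) (b k (adjoint ip (a m) v))) N -
       series (fun k => rip (T (b k (a m u))) (b k v)) N).
    by apply/funext => N; rewrite /series /= sumrB.
  by apply: cvgB; exact: hTb.
pose d m k := iter k L (sqnorm (commutator (a m) T)) xi.
pose g k := iter k L (sqnorm T) xi.
have d0 m k : (0 <= d m k)%E by apply: iter_transfer_ge0; exact: sqnorm_ge0.
have g0 k : (0 <= g k)%E by apply: iter_transfer_ge0; exact: sqnorm_ge0.
(* [harmonic_commutator] is summed over the vectors [b_w xi] with [w] of length [k]. Then [a m] is
   carried through [b_w] down to [xi], where it equals [b m], so the words become one letter
   longer. *)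
have dg k : (\sum_(0 <= m <oo) d m k + g k = g k.+1)%E.
  rewrite /d /g -iter_transfer_sum; last by move=> *; exact: sqnorm_ge0.
  rewrite -iter_transferD; [|by move=> *; rewrite ?nneseries_ge0 // => *; exact: sqnorm_ge0|
    by move=> *; exact: sqnorm_ge0].
  have -> : (fun u => \sum_(0 <= m <oo) sqnorm (commutator (a m) T) u + sqnorm T u)%E =
      (fun u => \sum_(0 <= m <oo) (sqnorm T \o a m) u)%E.
    by apply/funext => u; rewrite harmonic_commutator.
  rewrite iter_transfer_sum; last by move=> *; exact: sqnorm_ge0.
  apply: eq_eseriesr => m _; transitivity (iter k L (sqnorm T) (a m xi)).
    have bam j u : b j (a m u) = a m (b j u) by rewrite ab.
    exact: (iter_transfer_comm k (sqnorm T) bam xi).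
  by rewrite abxi.
(* [harmonic_commutator] is now applied to the commutator itself and the family [b], and the
   nonnegative sum of second commutators is dropped. *)
have dmono m k : (d m k <= d m k.+1)%E.
  rewrite /d iterSr; apply: iter_transfer_le => u; first exact: sqnorm_ge0.
  rewrite /L /transfer -(harmonic_commutator (bD m) ib (hD m)).
  by rewrite leeDr // nneseries_ge0 // => *; exact: sqnorm_ge0.
have dmono' m k j : (d m k <= d m (k + j)%N)%E.
  by elim: j => [|j ih]; rewrite ?addn0 // addnS (le_trans ih).
have dgle m k : (d m k + g k <= g k.+1)%E.
  rewrite -dg leeD2r // (@nneseriesD1 _ _ m) //.
  by rewrite leeDl // nneseries_ge0.
have [C C0 hC] := bop_bound bT.
(* The induction needs an arbitrary starting vector, since it passes from [v] to all [b m v]. The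
   column isometry [b] keeps the total squared norm equal to [|v|^2]. *)
have gC k : (g k <= (C ^+ 2 * rnorm xi ^+ 2)%:E)%E.
  rewrite /g; elim: k xi {abxi d g d0 g0 dg dmono dmono' dgle} => [|k ih] v /=.
    by rewrite lee_fin -exprMn lerXn2r ?nnegrE ?rnorm_ge0 ?mulr_ge0 ?rnorm_ge0.
  apply: (@le_trans _ _ (\sum_(0 <= m <oo) ((C ^+ 2 * rnorm (b m v) ^+ 2)%:E))%E).
    apply: lee_nneseries => // *; apply: iter_transfer_ge0; exact: sqnorm_ge0.
  under eq_eseriesr do rewrite EFinM.
  rewrite nneseriesZl; last by move=> *; rewrite lee_fin sqr_ge0.
  by rewrite (nneseries_EFin (ib v)).
have d_eq0 k : d n k = 0%E.
  (* As [d n] is nondecreasing, every step after [k] adds at least [d n k] to [g]. A positive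
     [d n k] would contradict boundedness by the Archimedean property, and the value [+oo] is
     excluded by [j = 1]. *)
  have hj j : (j%:R%:E * d n k + g k <= g (k + j)%N)%E.
    elim: j => [|j ih]; first by rewrite mul0e add0e addn0.
    rewrite addnS (le_trans _ (dgle n _)) // -natr1 EFinD ge0_muleDl ?lee_fin //.
    by rewrite mul1e addeAC addeC leeD.
  have : (forall j, j%:R%:E * d n k <= (C ^+ 2 * rnorm xi ^+ 2)%:E)%E.
    by move=> j; rewrite (le_trans _ (gC (k + j)%N)) // (le_trans _ (hj j)) // leeDl.
  have := d0 n k; case: (d n k) => [r| |] //; last first.
    by move=> _ /(_ 1%N); rewrite mul1e leye_eq.
  rewrite lee_fin => r0 hr; congr EFin; apply/eqP; rewrite eq_le r0 andbT leNgt.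
  apply/negP => r1; set B := C ^+ 2 * _ in hr.
  have B0 : 0 <= B by rewrite mulr_ge0 ?sqr_ge0.
  have := archi_boundP (divr_ge0 B0 r0); rewrite ltr_pdivrMr // ltNge.
  by have := hr (Num.bound (B / r)); rewrite -EFinM lee_fin => ->.
have := iter_transfer_eq0 (sqnorm_ge0 (commutator (a n) T)) (d_eq0 (size w)) erefl.
by rewrite /sqnorm => -[] /eqP; rewrite sqrf_eq0 => /eqP /rnorm_eq0.
Qed.

End Harmonic.

(** * Fixed points of row contractions *)

Section FixedOps.
Context (R : realType) (H : completeNormedModType R[i]).
Context (ip : {dot H for (@Num.conj R[i])}) (hip : hilbert_norm ip).
Local Notation rip := (rdot ip).
Implicit Types (x y : nat -> H -> H) (T : H -> H).

Lemma rdot_cvg (a : nat -> H) l u : a @ \oo --> l -> (fun n => rip (a n) u) @ \oo --> rip l u.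
Proof.
move=> /cvg_rnorm al; apply/cvgrPdist_lt => e e0.
have N1 : 0 < rnorm u + 1 by rewrite ltr_wpDl ?rnorm_ge0.
have [N hN] := al (e / (rnorm u + 1)) (divr_gt0 e0 N1).
exists N => // n Nn /=; rewrite -rdotBl (le_lt_trans (rdot_abs hip _ _)) //.
rewrite (@le_lt_trans _ _ (rnorm (l - a n) * (rnorm u + 1))) ?ler_wpM2l ?rnorm_ge0 ?lerDl //.
by rewrite -ltr_pdivlMr // hN.
Qed.

Lemma rdot_suml I (r : seq I) (F : I -> H) u :
  rip (\sum_(i <- r) F i) u = \sum_(i <- r) rip (F i) u.
Proof. exact: (big_morph (fun v => rip v u) (fun v w => rdotDl ip v w u) (rdot0l ip u)). Qed.

Lemma rdot_series (a : nat -> H) l u : series a @ \oo --> l ->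
  series (fun n => rip (a n) u) @ \oo --> rip l u.
Proof.
move=> al; have -> : series (fun n => rip (a n) u) = (fun n => rip (series a n) u).
  by apply/funext => n; rewrite /series /= rdot_suml.
exact: rdot_cvg.
Qed.

Section Row.
Context (y : nat -> H -> H) (yb : forall n, bounded_ops (y n)).
Hypothesis (y1 : sot_sum (fun n => y n \o adjoint ip (y n)) idfun).
Local Notation x n := (adjoint ip (y n)).

Lemma rdot_adj n u v : rip (y n u) v = rip u (x n v).
Proof. by rewrite /rdot (adjP hip (yb n)). Qed.

Lemma row_column_isometry : column_isometry (fun n => x n).
Proof.
move=> u; have -> : (fun n => rnorm (x n u) ^+ 2) = (fun n => rip (y n (x n u)) u).
  by apply/funext => n; rewrite rdot_adj (rdot_rnorm hip).
by rewrite -(rdot_rnorm hip); apply: (@rdot_series (fun n => y n (x n u))); exact: y1.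
Qed.

(** [sum_maps] is a [limn], so a fixed-point equation carries information only once the series is
    known to converge. Norm convergence comes from the Cauchy criterion. *)
Lemma row_sum_cvg T v : bounded_ops T ->
  exists l : H, series (fun n => Ad ip (y n) T v) @ \oo --> l.
Proof.
move=> bT; have [C C0 hC] := bop_bound bT; apply: rnorm_complete => e e0.
have C1 : 0 < C + 1 by rewrite ltr_wpDl.
pose q u := series (fun n => rnorm (x n u) ^+ 2).
have qle u n : q u n <= rnorm u ^+ 2.
  by apply: series_ge0_le_lim; [move=> k; exact: sqr_ge0|exact: row_column_isometry].
have dpos : 0 < (e / (C + 1)) ^+ 2 by rewrite exprn_gt0 // divr_gt0.
have : q v @ \oo --> rnorm v ^+ 2 by exact: row_column_isometry.
move=> /cvgrPdist_lt/(_ _ dpos)[N _ hN].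
have main m n : (N <= m)%N -> (m <= n)%N ->
    rnorm (series (fun n => Ad ip (y n) T v) n - series (fun n => Ad ip (y n) T v) m) < e.
  move=> Nm mn; rewrite /series /= (big_cat_nat (leq0n m) mn) /= addrAC subrr add0r.
  set s := \sum_(m <= _ < n) _.
  have tail u : \sum_(m <= k < n) rnorm (x k u) ^+ 2 = q u n - q u m.
    by rewrite /q /series /= (big_cat_nat (leq0n m) mn) /= addrAC subrr add0r.
  (* A block [s] is paired with itself, and each term [rip (T (x k v)) (x k s)] is split by the
     arithmetic-geometric inequality. The part in [x k s] is at most [|s|^2 / 2] and is absorbed on
     the left, leaving a tail of [|x k v|^2]. *)
  have hs : rnorm s ^+ 2 <= ((C + 1) ^+ 2 * \sum_(m <= k < n) rnorm (x k v) ^+ 2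
      + \sum_(m <= k < n) rnorm (x k s) ^+ 2) / 2.
    rewrite -(rdot_rnorm hip) {1}/s rdot_suml mulr_sumr -big_split /= mulr_suml.
    apply: ler_sum => k _; rewrite rdot_adj (le_trans (rdot_le hip _ _)) //.
    rewrite -exprMn.
    have h1 : rnorm (T (x k v)) <= (C + 1) * rnorm (x k v).
      by rewrite (le_trans (hC _)) // ler_wpM2r ?rnorm_ge0 ?lerDl.
    have := sqr_ge0 ((C + 1) * rnorm (x k v) - rnorm (x k s)).
    have := ler_wpM2r (rnorm_ge0 (x k s)) h1.
    set p := (C + 1) * _; set r := rnorm (x k s); set t := rnorm (T (x k v)).
    by clearbody p r t; move=> *; nra.
  rewrite -(@ltr_pXn2r _ 2) ?nnegrE ?rnorm_ge0 ?(ltW e0) //.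
  have h2 : \sum_(m <= k < n) rnorm (x k s) ^+ 2 <= rnorm s ^+ 2.
    rewrite tail (le_trans _ (qle s n)) // gerBl /q /series /=.
    by apply: sumr_ge0 => *; exact: sqr_ge0.
  have h3 : \sum_(m <= k < n) rnorm (x k v) ^+ 2 < (e / (C + 1)) ^+ 2.
    rewrite tail; have := hN m Nm; have := qle v n; rewrite -/(q v m) => *.
    rewrite (@le_lt_trans _ _ (rnorm v ^+ 2 - q v m)) ?lerD2r //.
    exact: le_lt_trans (ler_norm _) _.
  have h4 : (C + 1) ^+ 2 * \sum_(m <= k < n) rnorm (x k v) ^+ 2 < e ^+ 2.
    by rewrite mulrC -ltr_pdivlMr ?exprn_gt0 // -expr_div_n.
  lra.
exists N => m n Nm Nn; have [mn|nm] := leqP m n; last by rewrite main // ltnW.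
by rewrite rnormB main.
Qed.

Lemma fixed_ops_harmonic T :
  fixed_ops (sum_maps (fun n => Ad ip (y n))) T -> wot_harmonic ip (fun n => x n) T.
Proof.
move=> [bT fT] u v; have [l hl] := row_sum_cvg u bT.
have lE : l = T u by rewrite -{1}fT /sum_maps (cvg_lim (@norm_hausdorff _ H) hl).
have -> : (fun n => rip (T (x n u)) (x n v)) = (fun n => rip (Ad ip (y n) T u) v).
  by apply/funext => n; rewrite /Ad /= rdot_adj.
by rewrite -lE; exact: rdot_series.
Qed.

(** Unitality of the map; this supplies the inclusion of the scalars in the final equality. *)
Lemma fixed_ops_scale c :
  fixed_ops (sum_maps (fun n => Ad ip (y n))) (fun u => c *: u).
Proof.
split; first exact: bop_scale.
apply/funext => u; rewrite /sum_maps; apply: cvg_lim; first exact: norm_hausdorff.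
have -> : (fun n => Ad ip (y n) (fun w => c *: w) u) =
    (fun n => (y n \o adjoint ip (y n)) (c *: u)).
  by apply/funext => n; rewrite /Ad /= (bopZ (adj_bop hip (yb n))).
exact: y1.
Qed.
End Row.
End FixedOps.

(** * Commutants *)

Section Density.
Context (R : realType) (H : completeNormedModType R[i]).
Context (ip : {dot H for (@Num.conj R[i])}) (hip : hilbert_norm ip).

(** Linearity is not imposed, so that density arguments cover the conjugate-linear [J] together with
    bounded operators. *)
Definition lipschitz_map (F : H -> H) : Prop :=
  exists2 C : R, 0 <= C & forall u v, rnorm (F u - F v) <= C * rnorm (u - v).

Lemma bop_lipschitz T : bounded_ops T -> lipschitz_map T.
Proof.
move=> bT; have [C C0 hC] := bop_bound bT; exists C => // u v.
by rewrite -(bopB bT).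
Qed.

Lemma lipschitz_comp F G : lipschitz_map F -> lipschitz_map G -> lipschitz_map (F \o G).
Proof.
move=> [C C0 hC] [D D0 hD]; exists (C * D) => [|u v]; first exact: mulr_ge0.
by rewrite (le_trans (hC _ _)) // -mulrA ler_wpM2l.
Qed.

Lemma closure_lipschitz (A B : set H) F v : lipschitz_map F ->
  (forall a, A a -> B (F a)) -> closure A v -> closure B (F v).
Proof.
move=> [C C0 hC] AB /closureP Av; apply/closureP => e e0.
have C1 : 0 < C + 1 by rewrite ltr_wpDl.
have [a Aa va] := Av _ (divr_gt0 e0 C1); exists (F a); first exact: AB.
rewrite (le_lt_trans (hC _ _)) // (@le_lt_trans _ _ ((C + 1) * rnorm (v - a))) //.
  by rewrite ler_wpM2r ?rnorm_ge0 // lerDl.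
by rewrite mulrC -ltr_pdivlMr.
Qed.

Lemma lipschitz_eq (A : set H) F G v : lipschitz_map F -> lipschitz_map G ->
  (forall a, A a -> F a = G a) -> closure A v -> F v = G v.
Proof.
move=> [C C0 hC] [D D0 hD] FG /closureP Av.
apply/eqP; rewrite -subr_eq0; apply/eqP/(@rnorm_small _ _ _ (C + D)) => e e0.
have [a Aa va] := Av e e0.
rewrite (le_trans (rnorm_tri (F a) _ _)) // mulrDl lerD //.
  by rewrite (le_trans (hC _ _)) // ler_wpM2l // ltW.
by rewrite FG // rnormB (le_trans (hD _ _)) // ler_wpM2l // ltW.
Qed.

Lemma closure_orth (A : set H) d v : (forall a, A a -> ip a d = 0) ->
  closure A v -> ip v d = 0.
Proof.
move=> Ad Av.
suff rd c : rdot ip v (c *: d) = 0.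
  by rewrite ipE rd -[d]scale1r rd.
apply/eqP; rewrite -normr_le0; apply/ler_addgt0Pl => e e0; rewrite addr0.
have C1 : 0 < rnorm (c *: d) + 1 by rewrite ltr_wpDl ?rnorm_ge0.
have /closureP/(_ _ (divr_gt0 e0 C1))[a Aa va] := Av.
have -> : rdot ip v (c *: d) = rdot ip (v - a) (c *: d).
  by rewrite rdotBl {3}/rdot ipZr Ad // mulr0 subr0.
rewrite (le_trans (rdot_abs hip _ _)) //.
rewrite (@le_trans _ _ (rnorm (v - a) * (rnorm (c *: d) + 1))) ?ler_wpM2l ?rnorm_ge0 ?lerDl //.
by rewrite -ler_pdivlMr // ltW.
Qed.

Lemma orth_proj_comm K a : closed_subspace K -> bounded_ops a ->
  (forall u, K u -> K (a u)) -> (forall u, K u -> K (adjoint ip a u)) ->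
  forall v, orth_proj ip K (a v) = a (orth_proj ip K v).
Proof.
move=> hK ba aK a'K v; apply: (orth_proj_eq hip hK) => [|k Kk].
  exact/aK/(orth_proj_in hip hK).
by rewrite !(adjP hip ba) (orth_proj_orth hip hK) //; exact: a'K.
Qed.

Lemma closure_subspace (A : set H) : A 0 ->
  (forall c u v, A u -> A v -> A (c *: u + v)) -> closed_subspace (closure A).
Proof.
move=> A0 AP; split; first exact: subset_closure.
  move=> c u v /closureP Au /closureP Av; apply/closureP => e e0.
  have C1 : 0 < complex.Re `|c| + 1.
    by rewrite ltr_wpDl //; have := normr_ge0 c; move: `|c| => [p q]; rewrite lecE => /andP[].
  have [a Aa ua] := Au (e / 2 / (complex.Re `|c| + 1)) (ltac:(by rewrite !divr_gt0)).
  have [b Ab vb] := Av (e / 2) (ltac:(by rewrite divr_gt0)).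
  exists (c *: a + b); first exact: AP.
  rewrite opprD addrACA -scalerBr (le_lt_trans (rnormD _ _)) // [e]splitr ltrD // rnormZC.
  rewrite (@le_lt_trans _ _ ((complex.Re `|c| + 1) * rnorm (u - a))) //.
    by rewrite ler_wpM2r ?rnorm_ge0 // lerDl.
  by rewrite mulrC -ltr_pdivlMr.
by have /closure_id <- := @closed_closure _ A.
Qed.
End Density.

(** * Commutants, bicommutants and the subspaces [L2 M xi] *)

Section Commutant.
Context (R : realType) (H : completeNormedModType R[i]).
Context (ip : {dot H for (@Num.conj R[i])}) (hip : hilbert_norm ip).
Implicit Types (A B : set (H -> H)) (S T : H -> H).

Lemma commutantP A T : bounded_ops T -> (forall S, A S -> forall u, T (S u) = S (T u)) ->
  commutant A T.
Proof. by move=> bT h; split=> // S AS; apply/funext => u /=; exact: h. Qed.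

Lemma commutantE A S T u : commutant A T -> A S -> T (S u) = S (T u).
Proof. by move=> [_ h] /h /(congr1 (fun f => f u)). Qed.

Lemma commutant_bop A T : commutant A T -> bounded_ops T.
Proof. by case. Qed.

Lemma commutantS A B : A `<=` B -> commutant B `<=` commutant A.
Proof. by move=> AB T [bT h]; split=> // S /AB; exact: h. Qed.

Lemma sub_bicommutant A : A `<=` @bounded_ops R H -> A `<=` commutant (commutant A).
Proof.
move=> bA T AT; apply: commutantP => [|S cS u]; first exact: bA.
by rewrite (commutantE _ cS).
Qed.

Lemma commutant_adj A T : A `<=` @bounded_ops R H -> (forall S, A S -> A (adjoint ip S)) ->
  commutant A T -> commutant A (adjoint ip T).
Proof.
move=> bA Aa cT; have bT := commutant_bop cT.
apply: commutantP => [|S AS u]; first exact: adj_bop.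
apply: (ip_eqr hip) => v; have bS := bA _ AS.
rewrite -(adjP hip bT) -{1}(adjK hip bS) -(adjP hip (adj_bop hip bS)).
rewrite -(commutantE _ cT (Aa _ AS)) (adjP hip bT) (adjP hip (adj_bop hip bS)).
by rewrite (adjK hip bS).
Qed.

Lemma commutant_id A : A `<=` @bounded_ops R H -> commutant A idfun.
Proof. by move=> bA; apply: commutantP => //; exact: bop_id. Qed.

Lemma commutant_comp A S T : commutant A S -> commutant A T -> commutant A (S \o T).
Proof.
move=> cS cT; apply: commutantP => [|U AU u /=].
  by apply: bop_comp; [case: cS|case: cT].
by rewrite (commutantE _ cT) // (commutantE _ cS).
Qed.

Lemma commutant_lin A c S T : A `<=` @bounded_ops R H -> commutant A S -> commutant A T ->
  commutant A (fun u => c *: S u + T u).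
Proof.
move=> bA cS cT; have bS := commutant_bop cS; have bT := commutant_bop cT.
have -> : (fun u => c *: S u + T u) = (fun u => c *: S u - (- 1) *: T u).
  by apply/funext => u; rewrite scaleN1r opprK.
apply: commutantP => [|U AU u].
  apply: (@bop_sub _ _ (fun u => c *: S u) (fun u => (-1) *: T u)).
    exact: (bop_comp (@bop_scale _ _ c) bS).
  exact: (bop_comp (@bop_scale _ _ (-1)) bT).
by rewrite (bopB (bA _ AU)) !(bopZ (bA _ AU)) (commutantE _ cT) // (commutantE _ cS).
Qed.

(** This makes the bicommutant a competitor in the [smallest] defining [vN_generated], so the
    generated algebra lies inside it. *)
Lemma bicommutant_vN A : A `<=` @bounded_ops R H -> (forall S, A S -> A (adjoint ip S)) ->
  vN_algebra ip (commutant (commutant A)).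
Proof.
move=> bA Aa; have bA' : commutant A `<=` @bounded_ops R H by move=> ? [].
split; first by move=> ? [].
  move=> T; apply: commutant_adj => // S; exact: commutant_adj.
apply/seteqP; split; first by apply: commutantS; exact: sub_bicommutant.
by apply: sub_bicommutant => ? [].
Qed.

Section VN.
Context (M : set (H -> H)) (hM : vN_algebra ip M).
Lemma vN_bop x : M x -> bounded_ops x. Proof. by case: hM => + _ _; apply. Qed.
Lemma vN_adj x : M x -> M (adjoint ip x). Proof. by case: hM => _ + _; apply. Qed.
Lemma vN_bicommutant : commutant (commutant M) = M. Proof. by case: hM. Qed.
Let bM' : commutant M `<=` @bounded_ops R H. Proof. by move=> ? []. Qed.
Lemma vN_id : M idfun. Proof. by rewrite -vN_bicommutant; exact: commutant_id. Qed.
Lemma vN_comp x y : M x -> M y -> M (x \o y).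
Proof. by rewrite -vN_bicommutant; exact: commutant_comp. Qed.
Lemma vN_lin c x y : M x -> M y -> M (fun u => c *: x u + y u).
Proof. by rewrite -vN_bicommutant; exact: commutant_lin. Qed.

Lemma L2_closed_subspace xi : closed_subspace (L2 M xi).
Proof.
apply: closure_subspace => [|c _ _ [x Mx <-] [y My <-]].
  exists (fun u => (-1) *: idfun u + idfun u).
    by apply: vN_lin; exact: vN_id.
  by rewrite scaleN1r addNr.
by exists (fun u => c *: x u + y u) => //; exact: vN_lin.
Qed.

Lemma L2_invariant xi x u : M x -> L2 M xi u -> L2 M xi (x u).
Proof.
move=> Mx; apply: closure_lipschitz (bop_lipschitz (vN_bop Mx)) _ => _ [y My <-].
by exists (x \o y) => //; exact: vN_comp.
Qed.

Lemma L2_in xi x : M x -> L2 M xi (x xi).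
Proof. by move=> Mx; apply: subset_closure; exists x. Qed.

Lemma L2_cyclic xi : L2 M xi xi.
Proof. by have := L2_in (xi := xi) vN_id. Qed.

End VN.
End Commutant.

(** * The modular conjugation *)

Section Modular.
Context (R : realType) (H : completeNormedModType R[i]).
Context (ip : {dot H for (@Num.conj R[i])}) (hip : hilbert_norm ip).
Local Notation adj := (adjoint ip).
Context (M : set (H -> H)) (hM : vN_algebra ip M).
Context (xi : H) (xi_cyclic : closure [set x xi | x in M] = [set: H]).
Context (J : H -> H) (hJ : modular_conj ip M xi J).

Lemma JD u v : J (u + v) = J u + J v. Proof. by case: hJ. Qed.
Lemma JZ c u : J (c *: u) = Num.conj c *: J u. Proof. by case: hJ. Qed.
Lemma rnormJ u : rnorm (J u) = rnorm u. Proof. by rewrite /rnorm; case: hJ => _ _ -> _. Qed.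
Lemma Jxi x : M x -> J (x xi) = (adj x) xi. Proof. by case: hJ => _ _ _; apply. Qed.
Lemma JN u : J (- u) = - J u.
Proof. by rewrite -scaleN1r JZ rmorphN1 scaleN1r. Qed.
Lemma JB u v : J (u - v) = J u - J v.
Proof. by rewrite JD JN. Qed.

Lemma J_lipschitz : lipschitz_map J.
Proof. by exists 1 => // u v; rewrite -JB rnormJ mul1r. Qed.

Lemma cyclic_eq F G : lipschitz_map F -> lipschitz_map G ->
  (forall x, M x -> F (x xi) = G (x xi)) -> forall v, F v = G v.
Proof.
move=> hF hG FG v; apply: (lipschitz_eq hF hG (A := [set x xi | x in M])).
  by move=> _ [x Mx <-]; exact: FG.
by rewrite xi_cyclic.
Qed.

Lemma lipschitz_id : lipschitz_map (@idfun H).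
Proof. exact/bop_lipschitz/bop_id. Qed.

Lemma JK v : J (J v) = v.
Proof.
apply: (@cyclic_eq (J \o J) idfun); [|exact: lipschitz_id|].
  exact: lipschitz_comp J_lipschitz J_lipschitz.
by move=> x Mx /=; rewrite !Jxi ?(adjK hip (vN_bop hM Mx)) //; exact: vN_adj.
Qed.

Lemma rdotJ u v : rdot ip (J u) (J v) = rdot ip u v.
Proof.
have := rdot_sq hip (J u) (J v); rewrite -JD !rnormJ (rdot_sq hip); lra.
Qed.

(** Polarising the isometry [J] gives the real part. Antilinearity at ['i] reverses the imaginary
    part, hence the exchange of [u] and [v]. *)
Lemma ipJ u v : ip (J u) (J v) = ip v u.
Proof.
have conj_i : Num.conj (- 'i : R[i]) = 'i.
  by apply/eqP; rewrite eq_complex /= oppr0 opprK !eqxx.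
rewrite ipE rdotJ; have -> : 'i *: J v = J (- 'i *: v) by rewrite JZ conj_i.
rewrite rdotJ (ipC ip v u) (ipE ip u v) scaleNr rdotNr.
by [].
Qed.

Lemma ipJl u v : ip (J u) v = ip (J v) u.
Proof. by rewrite -{1}(JK v) ipJ. Qed.

Lemma ipJr u v : ip u (J v) = ip v (J u).
Proof. by rewrite ipC ipJl -ipC. Qed.

Lemma J_cyclic : J xi = xi.
Proof.
have := Jxi (vN_id hM); rewrite /= => ->.
by rewrite (adj_eq hip (@bop_id _ H) (S := idfun)).
Qed.

Definition Jconj (a : H -> H) : H -> H := J \o a \o J.

Lemma Jconj_bop a : bounded_ops a -> bounded_ops (Jconj a).
Proof.
move=> ba; have [C C0 hC] := bop_bound ba.
apply: (@bounded_opsP _ _ _ C) => [c u v|u] /=; last first.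
  by rewrite /Jconj /= rnormJ (le_trans (hC _)) // rnormJ.
by rewrite /Jconj /= !(JD, JZ) (bopP ba) !(JD, JZ) conjCK.
Qed.


Lemma Jconj_adj a : bounded_ops a -> adj (Jconj a) = Jconj (adj a).
Proof.
move=> ba; apply: (adj_eq hip (Jconj_bop ba)) => u v; rewrite /Jconj /=.
by rewrite ipJl -(ipJr _ u) (adjPr hip ba).
Qed.

Lemma Jconj_cyclic x : M x -> Jconj x xi = (adj x) xi.
Proof. by move=> Mx; rewrite /Jconj /= J_cyclic Jxi. Qed.

(** On [M xi] the operator [J x J] is right multiplication, [b xi |-> b x^* xi] ([key]), which
    commutes with left multiplication; density of [M xi] does the rest. *)
Lemma Jconj_commutant x : M x -> commutant M (Jconj x).
Proof.
move=> Mx; have bJx := Jconj_bop (vN_bop hM Mx).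
apply: commutantP => // y My; apply: cyclic_eq.
- exact: (bop_lipschitz (bop_comp bJx (vN_bop hM My))).
- exact: (bop_lipschitz (bop_comp (vN_bop hM My) bJx)).
move=> a Ma.
have key b : M b -> Jconj x (b xi) = b ((adj x) xi).
  move=> Mb; have bb := vN_bop hM Mb; have bx := vN_bop hM Mx.
  rewrite /Jconj /= Jxi // (Jxi (vN_comp hM Mx (vN_adj hM Mb))).
  by rewrite (adj_comp hip bx (adj_bop hip bb)) /= (adjK hip bb).
have /= -> := key _ (vN_comp hM My Ma); by rewrite /= key.
Qed.

(** Already [M xi] is contained in [M' xi], because [x xi = J x^* J xi]. *)
Lemma commutant_cyclic : closure [set x xi | x in commutant M] = [set: H].
Proof.
apply/seteqP; split=> // v _; have : closure [set x xi | x in M] v by rewrite xi_cyclic.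
apply: closureS => _ [x Mx <-]; exists (Jconj (adj x)).
  exact: (Jconj_commutant (vN_adj hM Mx)).
by rewrite Jconj_cyclic ?(adjK hip (vN_bop hM Mx)) //; exact: (vN_adj hM Mx).
Qed.

(** * The subspace [L2 P xi] of a subalgebra [P] *)

Section Subalgebra.
Context (P : set (H -> H)) (hP : vN_algebra ip P) (PM : P `<=` M).
Let K := L2 P xi.
Let hK : closed_subspace K. Proof. exact: (L2_closed_subspace hP). Qed.

Lemma L2_J u : K u -> K (J u).
Proof.
apply: closure_lipschitz J_lipschitz _ => _ [x Px <-]; exists (adj x); first exact: vN_adj.
by rewrite Jxi //; exact: PM.
Qed.

Lemma L2_Jconj x u : P x -> K u -> K (Jconj x u).
Proof. by move=> Px Ku; apply: L2_J; apply: (L2_invariant hP Px); exact: L2_J. Qed.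

Lemma L2_eq F G u : bounded_ops F -> bounded_ops G ->
  (forall x, P x -> F (x xi) = G (x xi)) -> K u -> F u = G u.
Proof.
move=> bF bG FG; apply: lipschitz_eq; [exact: bop_lipschitz|exact: bop_lipschitz|].
by move=> _ [x Px <-]; exact: FG.
Qed.

(* Tomita: [J x' xi] and [x'^* xi] have the same projection on [L2 P xi] for [x'] in [P']. *)
Lemma commutant_adj_cyclic x' w : commutant P x' -> K w ->
  ip w (adj x' xi) = ip w (J (x' xi)).
Proof.
move=> cx Kw; have bx := commutant_bop cx.
apply/eqP; rewrite -subr_eq0 -ipBr; apply/eqP/(closure_orth hip _ Kw) => _ [a Pa <-].
rewrite ipBr ipJr (Jxi (PM Pa)) -(adjP hip (vN_bop hP Pa)) -(adjP hip bx).
by rewrite (commutantE _ cx Pa) subrr.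
Qed.

Section Generators.
Context (z : nat -> H -> H) (Pz : forall n, P (z n)).
Context (zadj : forall n, exists k, adj (z n) = z k).
Context (zgen : P `<=` commutant (commutant (range z))).
Let bz n : bounded_ops (z n). Proof. exact: (vN_bop hP (Pz n)). Qed.

Lemma gen_commutant T : bounded_ops T -> (forall n u, T (z n u) = z n (T u)) -> commutant P T.
Proof.
move=> bT Tz; apply: commutantP => // x /zgen cx u.
by rewrite (commutantE _ cx) //; apply: commutantP => // _ [n _ <-].
Qed.

Lemma zadj' n : exists k, z n = adj (z k).
Proof. by have [k hk] := zadj n; exists k; rewrite -hk (adjK hip (bz n)). Qed.

Lemma gen_commutant_Jconj T : bounded_ops T ->
  (forall n u, T (Jconj (adj (z n)) u) = Jconj (adj (z n)) (T u)) -> commutant P (Jconj T).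
Proof.
move=> bT Tz; apply: gen_commutant => [|n u]; first exact: Jconj_bop.
have [k ->] := zadj' n.
rewrite /Jconj /=; apply: (can_inj JK); rewrite JK.
by have := Tz k (J u); rewrite /Jconj /= JK.
Qed.

(** The [z]'s are closed under adjoints, so [N] reduces them and its projection lies in [P']. That
    projection fixes [xi], hence fixes every [x xi] with [x] in [P]. *)
Lemma L2_minimal N : closed_subspace N -> N xi -> (forall n u, N u -> N (z n u)) -> K `<=` N.
Proof.
move=> hN Nxi Nz u.
have cq : commutant P (orth_proj ip N).
  apply: gen_commutant => [|n v]; first exact: orth_proj_bop.
  apply: orth_proj_comm => // [w|w]; first exact: Nz.
  by have [k ->] := zadj n; exact: Nz.
have -> : N = closure N.
  by apply/seteqP; split; [exact: subset_closure|case: hN].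
apply: closureS => _ [x Px <-].
by rewrite -(orth_proj_id hip hN Nxi) -(commutantE _ cq Px); exact: (orth_proj_in hip hN).
Qed.

(* Here [J e_N J], rather than the projection [e_N] onto [N], lies in [P']. *)
Lemma L2_minimal_Jconj N : closed_subspace N -> N xi ->
  (forall n u, N u -> N (Jconj (adj (z n)) u)) -> K `<=` N.
Proof.
move=> hN Nxi Nz u.
have cq : commutant P (Jconj (orth_proj ip N)).
  apply: gen_commutant_Jconj => [|n v]; first exact: orth_proj_bop.
  have ba := adj_bop hip (bz n).
  apply: orth_proj_comm => // [|w|w]; [exact: Jconj_bop|exact: Nz|].
  by have [k hk] := zadj n; rewrite Jconj_adj // hk; exact: Nz.
have -> : N = closure N.
  by apply/seteqP; split; [exact: subset_closure|case: hN].
apply: closureS => _ [x Px <-].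
have Px' := vN_adj hP Px.
have : x xi = orth_proj ip N (x xi).
  rewrite -{1}(adjK hip (vN_bop hP Px)) -Jxi; last exact: PM.
  have := commutantE xi cq Px'; rewrite {2}/Jconj /= J_cyclic (orth_proj_id hip hN Nxi).
  rewrite J_cyclic.
  move=> <-; rewrite /Jconj /= JK Jxi; last exact: PM.
  by rewrite (adjK hip (vN_bop hP Px)).
by move=> ->; exact: (orth_proj_in hip hN).
Qed.

End Generators.
End Subalgebra.
End Modular.

(** * Bounded extensions *)

Section Bounds.
Context (R : realType).

(** Increments of a convex sequence never decrease, so a positive first one would force linear
    growth. *)
Lemma convex_bounded_le (t : nat -> R) (B : R) :
  (forall n, 2 * t n.+1 <= t n + t n.+2) -> (forall n, t n <= B) -> t 1%N <= t 0%N.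
Proof.
move=> ct tB; rewrite leNgt; apply/negP => t01.
have step n : t 1%N - t 0%N <= t n.+1 - t n.
  by elim: n => // n ih; have := ct n; lra.
have grow n : t 0%N + n%:R * (t 1%N - t 0%N) <= t n.
  elim: n => [|n ih]; first by rewrite mul0r addr0.
  by have := step n; rewrite -natr1; lra.
have d0 : 0 < t 1%N - t 0%N by rewrite subr_gt0.
have := archi_boundP (divr_ge0 (_ : 0 <= B - t 0%N) (ltW d0)).
rewrite subr_ge0 => /(_ (tB _)); rewrite ltr_pdivrMr // ltNge.
by rewrite lerBrDl (le_trans (grow _)).
Qed.

(** After division by [C ^+ n] the sequence is bounded and still log-convex, hence convex by the
    arithmetic-geometric inequality. *)
Lemma logconvex_geometric_le (r : nat -> R) (B C : R) : 0 < C ->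
  (forall n, 0 <= r n) -> (forall n, r n.+1 ^+ 2 <= r n * r n.+2) ->
  (forall n, r n <= B * C ^+ n) -> r 1%N <= C * r 0%N.
Proof.
move=> C0 r0 rr rB.
have Cn n : 0 < C ^+ n by rewrite exprn_gt0.
have := @convex_bounded_le (fun n => r n / C ^+ n) B.
rewrite expr1 expr0 divr1 ler_pdivrMr // mulrC; apply=> n; last by rewrite ler_pdivrMr.
have t0 m : 0 <= r m / C ^+ m by rewrite divr_ge0 // ltW.
have tt : (r n.+1 / C ^+ n.+1) ^+ 2 <= (r n / C ^+ n) * (r n.+2 / C ^+ n.+2).
  rewrite mulf_div -exprD expr_div_n -exprM.
  have -> : (n + n.+2 = n.+1 * 2)%N by rewrite muln2 -addnn addnS addSn.
  by rewrite ler_pM2r ?invr_gt0.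
have := t0 n; have := t0 n.+1; have := t0 n.+2; move: tt.
set p := r n / _; set q := r n.+1 / _; set s := r n.+2 / _.
clearbody p q s => h1 s0 q0 p0.
rewrite -(@ler_pXn2r _ 2) ?nnegrE ?mulr_ge0 ?addr_ge0 //.
have := sqr_ge0 (p - s); nra.
Qed.

Context (H : completeNormedModType R[i]).
Context (ip : {dot H for (@Num.conj R[i])}) (hip : hilbert_norm ip).
Local Notation rip := (rdot ip).

(* [G = X^* X] commutes with [A = A^*], hence [|X A^n u|] is log-convex in [n]. *)
Lemma commuting_bound (X G A : H -> H) (C : R) : bounded_ops X -> 0 < C ->
  (forall u v, rip (X u) (X v) = rip (G u) v) ->
  (forall u v, rip (A u) v = rip u (A v)) ->
  (forall u, G (A u) = A (G u)) -> (forall u, rnorm (A u) <= C * rnorm u) ->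
  forall u, rnorm (X (A u)) <= C * rnorm (X u).
Proof.
move=> bX C0 XG sA GA hA u; have [D D0 hD] := bop_bound bX.
pose r n := rnorm (X (iter n A u)).
apply: (@logconvex_geometric_le r (D * rnorm u) C) => // [n|n|n]; first exact: rnorm_ge0.
  rewrite /r -(rdot_rnorm hip) XG /= GA sA -XG (le_trans (rdot_le hip _ _)) //.
rewrite /r (le_trans (hD _)) // -mulrA ler_wpM2l //.
elim: n => [|n ih] /=; first by rewrite expr0 mulr1.
by rewrite (le_trans (hA _)) // exprS mulrCA ler_wpM2l // ltW.
Qed.

(** Linearity of [A] lets the bound apply to differences, so [x xi |-> x eta] is well defined and
    Lipschitz on a dense subspace. *)
Lemma dense_extension (A : set (H -> H)) (xi eta : H) (C : R) :
  (forall c x y, A x -> A y -> A (fun u => c *: x u + y u)) ->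
  A (fun=> 0) -> 0 <= C -> closure [set x xi | x in A] = [set: H] ->
  (forall x, A x -> rnorm (x eta) <= C * rnorm (x xi)) ->
  exists2 Z : H -> H, bounded_ops Z & forall x, A x -> Z (x xi) = x eta.
Proof.
move=> Alin A0 C0 Ad AC.
have Asub x y : A x -> A y -> rnorm (x eta - y eta) <= C * rnorm (x xi - y xi).
  move=> Ax Ay; have := AC _ (Alin (-1) _ _ Ay Ax).
  by rewrite !scaleN1r ![- _ + _]addrC.
have appr h (e : R) : 0 < e -> exists2 x, A x & rnorm (h - x xi) < e.
  move=> e0; have : closure [set x xi | x in A] h by rewrite Ad.
  by move/closureP/(_ e e0) => [_ [x Ax <-] hx]; exists x.
(* The inequality for all [x] at once pins down the value at [h]; [w] is a limit of [x eta] as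
   [x xi] tends to [h]. *)
have ex h : exists w, forall x, A x -> rnorm (w - x eta) <= C * rnorm (h - x xi).
  pose E n := [set x eta | x in [set x | A x /\ rnorm (h - x xi) < n.+1%:R^-1]].
  have [n|m n mn|e e0|w hw] := @complete_nested _ _ E.
  - have [x Ax hx] := appr h n.+1%:R^-1 (ltac:(by rewrite invr_gt0)).
    by exists (x eta); exists x.
  - move=> _ [x [Ax hx] <-]; exists x => //; split=> //.
    by rewrite (lt_le_trans hx) // lef_pV2 ?posrE // ler_nat.
  - have C1 : 0 < 2 * (C + 1) by rewrite mulr_gt0 // ltr_wpDl.
    have e1 : 0 < e / (2 * (C + 1)) by rewrite divr_gt0.
    exists (Num.bound (e / (2 * (C + 1)))^-1) => _ _ [x [Ax hx] <-] [y [Ay hy] <-].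
    set n := Num.bound _ in hx hy.
    have hn : n.+1%:R^-1 < e / (2 * (C + 1)).
      by rewrite invf_plt ?posrE // (lt_trans (archi_boundP _)) ?ltr_nat // invr_ge0 ltW.
    have h1 : rnorm (x xi - y xi) <= 2 * (e / (2 * (C + 1))).
      rewrite (le_trans (rnorm_tri h _ _)) // rnormB mulr_natl mulr2n.
      by apply: lerD; apply: ltW; exact: lt_trans hn.
    rewrite (le_lt_trans (Asub _ _ Ax Ay)) // (le_lt_trans (ler_wpM2l C0 h1)) //.
    have := divfK (lt0r_neq0 C1) e; move: e1; set k := e / _; clearbody k.
    by move=> *; nra.
  exists w => x Ax; apply/ler_addgt0Pr => e e0.
  have C1 : 0 < C + 1 by rewrite ltr_wpDl.
  have e1 : 0 < e / (C + 1) by rewrite divr_gt0.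
  have := hw (Num.bound (e / (C + 1))^-1) => /closureP/(_ _ e1)[_ [y [Ay hy] <-] wy].
  set n := Num.bound _ in hy.
  have hn : n.+1%:R^-1 < e / (C + 1).
    by rewrite invf_plt ?posrE // (lt_trans (archi_boundP _)) ?ltr_nat // invr_ge0 ltW.
  rewrite (le_trans (rnorm_tri (y eta) _ _)) //.
  rewrite (le_trans (lerD (ltW wy) (Asub _ _ Ay Ax))) //.
  have h1 : rnorm (y xi - x xi) <= e / (C + 1) + rnorm (h - x xi).
    by rewrite (le_trans (rnorm_tri h _ _)) // lerD2r rnormB ltW // (lt_trans hy).
  have := ler_wpM2l C0 h1; have := divfK (lt0r_neq0 C1) e; move: e1; set k := e / _.
  by clearbody k; move=> *; nra.
have [Z hZ] := choice ex.
have Zlin c u v : Z (c *: u + v) = c *: Z u + Z v.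
  apply/eqP; rewrite -subr_eq0; apply/eqP.
  have N0 : 0 <= complex.Re `|c|.
    by have := normr_ge0 c; move: `|c| => [p q]; rewrite lecE => /andP[].
  (* Both [Z (c *: u + v)] and [c *: Z u + Z v] are compared with [c *: x eta + y eta]. Each error
     is at most [(|c| C + C) e], whence the factor 2. *)
  apply: (@rnorm_small _ _ _ (2 * (complex.Re `|c| * C + C))) => e e0.
  have [x Ax hx] := appr u e e0; have [y Ay hy] := appr v e e0.
  have h1 := hZ (c *: u + v) _ (Alin c _ _ Ax Ay).
  have h2 := hZ u _ Ax; have h3 := hZ v _ Ay.
  have e2 (p q p' q' : H) : c *: p + q - (c *: p' + q') = c *: (p - p') + (q - q') :> H.
    by rewrite scalerBr opprD addrACA.
  have h4 (p q p' q' : H) : rnorm (c *: p + q - (c *: p' + q')) <=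
      complex.Re `|c| * rnorm (p - p') + rnorm (q - q').
    by rewrite e2 -rnormZC rnormD.
  rewrite (le_trans (rnorm_tri (c *: x eta + y eta) _ _)) //.
  have h5 := h4 u v (x xi) (y xi); have h6 := h4 (Z u) (Z v) (x eta) (y eta).
  rewrite [X in _ + X]rnormB; move: h1 h2 h3 h5 h6 hx hy.
  move: (complex.Re `|c|) N0 => N N0.
  set q1 := rnorm (Z (c *: u + v) - _); set q2 := rnorm (Z u - _); set q3 := rnorm (Z v - _).
  set q4 := rnorm (c *: u + v - _); set q5 := rnorm (_ *: Z u + _ - _).
  set q6 := rnorm (u - _); set q7 := rnorm (v - _).
  clearbody q1 q2 q3 q4 q5 q6 q7 => h1 h2 h3 h5 h6 h7 h8.
  have k1 : N * q2 <= N * (C * e).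
    by rewrite ler_wpM2l // (le_trans h2) // ler_wpM2l // ltW.
  have k2 : N * q6 <= N * e by rewrite ler_wpM2l // ltW.
  have k3 : C * q4 <= C * (N * e + e).
    by rewrite ler_wpM2l // (le_trans h5) // lerD // ltW.
  have k4 : C * q7 <= C * e by rewrite ler_wpM2l // ltW.
  lra.
exists Z; last first.
  move=> x Ax; apply/eqP; rewrite -subr_eq0; apply/eqP/rnorm_eq0/eqP.
  by rewrite eq_le rnorm_ge0 (le_trans (hZ _ _ Ax)) // subrr rnorm0 mulr0.
apply: (@bounded_opsP _ _ _ C) => // u.
by have := hZ u _ A0; rewrite !subr0.
Qed.

End Bounds.

(** * Central elements of the corner *)

Section Corner.
Context (R : realType) (H : completeNormedModType R[i]).
Context (ip : {dot H for (@Num.conj R[i])}) (hip : hilbert_norm ip).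
Local Notation adj := (adjoint ip).
Context (M : set (H -> H)) (hM : vN_algebra ip M).
Context (xi : H) (xi_cyclic : closure [set x xi | x in M] = [set: H]).
Context (J : H -> H) (hJ : modular_conj ip M xi J).
Context (P : set (H -> H)) (hP : is_factor ip P) (PM : P `<=` M).
Let hPv : vN_algebra ip P. Proof. by case: hP. Qed.
Let K := L2 P xi.
Let hK : closed_subspace K. Proof. exact: (L2_closed_subspace hPv). Qed.
Local Notation e := (orth_proj ip K).
Let be : bounded_ops e. Proof. exact: orth_proj_bop. Qed.
Let bP : P `<=` @bounded_ops R H. Proof. by move=> x; exact: (vN_bop hPv). Qed.
Let bP' : commutant P `<=` @bounded_ops R H. Proof. by move=> ? []. Qed.

Let e_comm : commutant P e.
Proof.
apply: commutantP => // x Px u; apply: orth_proj_comm => //.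
- exact: (vN_bop hPv Px).
- by move=> v; exact: (L2_invariant hPv Px).
- by move=> v; exact: (L2_invariant hPv (vN_adj hPv Px)).
Qed.

Context (S : H -> H) (cS : commutant P S) (cJS : commutant P (Jconj J S)).
Hypotheses (SK : forall u, K (S u)) (Se : forall u, S (e u) = S u).
Let bS : bounded_ops S. Proof. by case: cS. Qed.
Let Kxi : K xi. Proof. exact: (L2_cyclic hPv). Qed.
Let exi : e xi = xi. Proof. exact: orth_proj_id. Qed.
Let eS u : e (S u) = S u. Proof. exact: orth_proj_id. Qed.

Let S_adj_in u : K ((adj S) u).
Proof.
have -> : (adj S) = e \o (adj S).
  apply: (adj_eq hip bS) => u1 v /=.
  by rewrite -(orth_proj_sym hip hK) -(adjP hip bS) Se.
exact: orth_proj_in.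
Qed.

Let cS' : commutant P (adj S).
Proof. by apply: commutant_adj => // x; exact: (vN_adj hPv). Qed.

Let S_Jconj x u : P x -> S (Jconj J x u) = Jconj J x (S u).
Proof.
move=> Px; have := commutantE (J u) cJS Px; rewrite /Jconj /= => h.
by rewrite -(JK hip hM xi_cyclic hJ (S _)) h !(JK hip hM xi_cyclic hJ).
Qed.

(** The difference lies in [K], and by [commutant_adj_cyclic] it is also orthogonal to [K]. *)
Let JSxi : J (S xi) = (adj S) xi.
Proof.
apply/eqP; rewrite -subr_eq0; apply/eqP/rnorm_eq0/eqP; rewrite -sqrf_eq0 -(rdot_rnorm hip).
have Kd : K (J (S xi) - (adj S) xi).
  exact: (csB hK (L2_J hJ hPv PM (@SK xi)) (@S_adj_in xi)).
by rewrite /rdot ipBr (commutant_adj_cyclic hip hM xi_cyclic hJ hPv PM cS Kd) subrr.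
Qed.

Let corner x' u := e (x' (e u)).

(** Both sides lie in [K] and are tested against [b xi], [b] in [P]. Moving [x'] and [b] across
    turns the left side into [ip (S (b^* xi)) (x'^* xi)]. With [b^* xi = J b J xi], Tomita's
    identity replaces [x'^* xi] by [J x' xi]; removing [J] and using [J S xi = S^* xi] gives the
    right side. *)
Let corner_cyclic_comm x' : commutant P x' -> corner x' (S xi) = S (corner x' xi).
Proof.
move=> cx; have bx := commutant_bop cx.
apply/eqP; rewrite -subr_eq0; apply/eqP/rnorm_eq0/eqP; rewrite -sqrf_eq0 -(rdot_rnorm hip).
set d := _ - _; have Kd : K d by apply: (csB hK) => //; exact: orth_proj_in.
suff h b : P b -> ip (corner x' (S xi)) (b xi) = ip (S (corner x' xi)) (b xi).
  rewrite /rdot ipC (closure_orth hip _ Kd) ?conjC0 // => _ [b Pb <-].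
  by rewrite /d ipC ipBl h // subrr conjC0.
move=> Pb; have bb := vN_bop hPv Pb.
rewrite /corner (orth_proj_orth hip hK); last exact: (L2_in Pb).
rewrite eS exi Se (adjP hip bx).
rewrite (commutantE _ (commutant_adj hip _ _ cx) Pb) //; last first.
  by move=> y; exact: (vN_adj hPv).
rewrite (adjPr hip bb) -(commutantE _ cS (vN_adj hPv Pb)).
rewrite -(Jxi hJ (PM Pb)) -{1}(J_cyclic hip hM hJ) -/((Jconj J b) xi) S_Jconj //.
rewrite (commutant_adj_cyclic hip hM xi_cyclic hJ hPv PM cx); last first.
  exact: (L2_Jconj hJ hPv PM Pb (@SK xi)).
rewrite /Jconj /= (ipJ hip hJ) JSxi.
by rewrite -(commutantE _ cS' Pb) -(adjP hip bS).
Qed.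

Let corner_bop x' : commutant P x' -> bounded_ops (corner x').
Proof. by move=> [bx _]; exact: (bop_comp be (bop_comp bx be)). Qed.

(** Both operators commute with [P], so agreement at [xi] spreads to [P xi], then to [K] by density,
    and to all vectors because [S = S e]. *)
Let corner_comm x' u : commutant P x' -> corner x' (S u) = S (corner x' u).
Proof.
move=> cx; have bc := corner_bop cx.
suff h v : K v -> corner x' (S v) = S (corner x' v).
  rewrite -Se h; last exact: orth_proj_in.
  by rewrite /corner (orth_proj_idem hip hK).
apply: (L2_eq (P := P) (xi := xi) (bop_comp bc bS) (bop_comp bS bc)) => a Pa /=.
have cc : commutant P (corner x').
  exact: (commutant_comp e_comm (commutant_comp cx e_comm)).
rewrite (commutantE _ cS Pa) (commutantE _ cc Pa) corner_cyclic_comm //.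
by rewrite (commutantE _ cc Pa) (commutantE _ cS Pa).
Qed.

(** [commuting_bound] is applied with [X = x' e], [G = e x'^* x' e] and [A = S^* S], so the constant
    does not depend on [x']. Adding 1 to [C] makes it positive, and [C + 1 <= (C + 1)^2] avoids a
    square root at the end. *)
Let S_cyclic_bound : exists2 D : R, 0 <= D & forall x', commutant P x' ->
  rnorm (x' (S xi)) <= D * rnorm (x' xi).
Proof.
have bSa := adj_bop hip bS; have bA := bop_comp bSa bS.
have [C C0 hC] := bop_bound bA.
exists (C + 1) => [|x' cx]; first by rewrite addr_ge0.
have bx := commutant_bop cx.
have C1 : 0 < C + 1 by rewrite ltr_wpDl.
have cxa : commutant P (adj x') by apply: commutant_adj => // y; exact: (vN_adj hPv).
pose G := corner ((adj x') \o x').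
have cg : commutant P ((adj x') \o x') by exact: commutant_comp.
have bX : bounded_ops (x' \o e) by exact: bop_comp.
have XG u v : rdot ip (x' (e u)) (x' (e v)) = rdot ip (G u) v.
  by rewrite /G /corner /rdot (orth_proj_sym hip hK) /= (adjPr hip bx).
have GS u : G (S u) = S (G u) by exact: corner_comm.
have Gsym u v : rdot ip (G u) v = rdot ip u (G v) by rewrite -XG rdotC XG rdotC.
have Sadj u v : rdot ip (S u) v = rdot ip u (adj S v) by rewrite /rdot (adjP hip bS).
have GSa u : G (adj S u) = adj S (G u).
  by apply: (rdot_eqr hip) => w; rewrite -Gsym -!Sadj -GS Gsym.
have := @commuting_bound _ _ _ hip (x' \o e) G ((adj S) \o S) (C + 1) bX C1 XG.
have hA u : rnorm (((adj S) \o S) u) <= (C + 1) * rnorm u.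
  by rewrite (le_trans (hC u)) // ler_wpM2r ?rnorm_ge0 ?lerDl.
move=> /(_ _ _ hA xi) /= h.
have {h} : rnorm (x' (e ((adj S) (S xi)))) <= (C + 1) * rnorm (x' (e xi)).
  apply: h => [u v|u]; last by rewrite GSa GS.
  by rewrite -Sadj rdotC -Sadj rdotC.
rewrite exi => h.
rewrite -(@ler_pXn2r _ 2) ?nnegrE ?mulr_ge0 ?rnorm_ge0 ?(ltW C1) //.
have -> : rnorm (x' (S xi)) ^+ 2 = rdot ip (x' (e xi)) (x' (e ((adj S) (S xi)))).
  rewrite -(rdot_rnorm hip) -{1 2}eS XG GS XG.
  by [].
rewrite exi (le_trans (rdot_le hip _ _)) // (le_trans (ler_wpM2l (rnorm_ge0 _) h)) //.
have := rnorm_ge0 (x' xi); set q := rnorm _; clearbody q => q0.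
have : 0 <= q ^+ 2 * C * (C + 1) by rewrite !mulr_ge0 ?sqr_ge0 // ltW.
nra.
Qed.

Lemma corner_central_scalar : exists c, forall u, S u = c *: e u.
Proof.
have [D D0 hD] := S_cyclic_bound.
have P'cyc : closure [set x xi | x in commutant P] = [set: H].
  apply/seteqP; split=> // v _.
  have : closure [set x xi | x in commutant M] v.
    by rewrite (commutant_cyclic hip hM xi_cyclic hJ).
  by apply: closureS => _ [x cx <-]; exists x => //; exact: commutantS cx.
have P'0 : commutant P (fun=> 0).
  have -> : (fun=> 0) = (fun u : H => (-1) *: idfun u + idfun u).
    by apply/funext => u; rewrite scaleN1r addNr.
  by apply: commutant_lin => //; exact: commutant_id.
have [|Z bZ hZ] := @dense_extension _ _ (commutant P) xi (S xi) D _ P'0 D0 P'cyc hD.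
  by move=> c x y; exact: commutant_lin.
have Zeq F G : bounded_ops F -> bounded_ops G ->
    (forall x, commutant P x -> F (x xi) = G (x xi)) -> forall v, F v = G v.
  move=> bF bG FG v.
  apply: (@lipschitz_eq _ _ [set x xi | x in commutant P]).
  - exact: bop_lipschitz.
  - exact: bop_lipschitz.
  - by move=> _ [x cx <-]; exact: FG.
  - by rewrite P'cyc.
(* For [p] in [P], [p xi = J p^* J xi] with [J p^* J] in [P']. Thus [Z (p x xi) = Z (x p xi)] falls
   under the defining formula of [Z], and [S] passes through [J p^* J]. *)
have cZ : commutant P Z.
  apply: commutantP => // p Pp; have bp := vN_bop hPv Pp.
  apply: (Zeq (Z \o p) (p \o Z)) => [||x cx /=]; [exact: bop_comp..|].
  have cJ : commutant P (Jconj J (adj p)).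
    apply: (commutantS PM); apply: (Jconj_commutant hip hM xi_cyclic hJ).
    exact: (PM (vN_adj hPv Pp)).
  have pxi : p xi = Jconj J (adj p) xi.
    rewrite (Jconj_cyclic hip hM hJ) ?(adjK hip bp) //; exact: (PM (vN_adj hPv Pp)).
  rewrite hZ // -(commutantE _ cx Pp) pxi.
  rewrite -[x (_ xi)]/((x \o Jconj J (adj p)) xi) hZ; last exact: commutant_comp.
  rewrite /= -S_Jconj; last exact: (vN_adj hPv).
  by rewrite -pxi (commutantE _ cS Pp) (commutantE _ cx Pp).
have ccZ : commutant (commutant P) Z.
  apply: commutantP => // y cy; apply: (Zeq (Z \o y) (y \o Z)) => [||x cx /=].
  - by apply: bop_comp => //; case: cy.
  - by apply: bop_comp => //; case: cy.
  by rewrite hZ // -[y (x xi)]/((y \o x) xi) hZ //; exact: commutant_comp.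
have : (P `&` commutant P) Z by split=> //; rewrite -(vN_bicommutant hPv).
rewrite hP.2 => -[c _ cE].
(* The defining formula of [Z] at [x' = 1]. *)
have Sxi : S xi = c *: xi.
  have := hZ _ (commutant_id bP); rewrite /= => <-.
  by rewrite -cE.
exists c => u; rewrite -Se; move: (e u) (orth_proj_in hip hK u).
move=> v Kv. refine (@L2_eq _ _ xi P S (fun w => c *: w) v bS (@bop_scale _ _ c) _ Kv) => a Pa.
by rewrite (commutantE _ cS Pa) Sxi (bopZ (vN_bop hPv Pa)).
Qed.

End Corner.

(** * Biharmonic operators *)

Section Biharmonic.
Context (R : realType) (H : completeNormedModType R[i]).
Context (ip : {dot H for (@Num.conj R[i])}) (hip : hilbert_norm ip).
Local Notation adj := (adjoint ip).
Context (M : set (H -> H)) (hM : vN_algebra ip M).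
Context (xi : H) (xi_cyclic : closure [set x xi | x in M] = [set: H]).
Context (J : H -> H) (hJ : modular_conj ip M xi J).
Context (z : nat -> H -> H) (hz : frakS ip M z).
Let P := vN_generated ip (range z).
Context (hP : is_factor ip P).
Let hPv : vN_algebra ip P. Proof. by case: hP. Qed.
Let K := L2 P xi.
Let hK : closed_subspace K. Proof. exact: (L2_closed_subspace hPv). Qed.
Local Notation e := (jones_proj ip P xi).

Let Mz n : M (z n). Proof. by case: hz. Qed.
Let zadj n : exists k, adj (z n) = z k. Proof. by case: hz => _ _ _; apply. Qed.
Let bz n : bounded_ops (z n). Proof. exact: (vN_bop hM (Mz n)). Qed.
Let bza n : bounded_ops (adj (z n)). Proof. exact: adj_bop. Qed.

Let PM : P `<=` M.
Proof. by apply: smallest_sub => // _ [n _ <-]. Qed.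
Let Pz n : P (z n). Proof. by apply: (@sub_gen_smallest _ _ (range z)); exists n. Qed.
Let Pza n : P (adj (z n)). Proof. exact: (vN_adj hPv (Pz n)). Qed.

Let zgen : P `<=` commutant (commutant (range z)).
Proof.
have bzr : range z `<=` @bounded_ops R H by move=> _ [n _ <-]; exact: bz.
apply: smallest_sub; last exact: sub_bicommutant.
apply: bicommutant_vN => // _ [n _ <-].
by have [k ->] := zadj n; exists k.
Qed.

(** The coefficients of [phi] are [J z_n J = (y n)^*], so its fixed operators are harmonic for the
    family [y]. *)
Let y n := Jconj J (adj (z n)).
Let yb n : bounded_ops (y n). Proof. exact: (Jconj_bop hJ (bza n)). Qed.
Let yadjE n : adj (y n) = Jconj J (z n).
Proof. by rewrite (Jconj_adj hip hM xi_cyclic hJ (bza n)) (adjK hip (bz n)). Qed.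
Let bw n : bounded_ops (Jconj J (z n)). Proof. exact: (Jconj_bop hJ (bz n)). Qed.
Let wadjE n : adj (Jconj J (z n)) = y n.
Proof. exact: (Jconj_adj hip hM xi_cyclic hJ (bz n)). Qed.

Let Jcomm x n u : M x -> Jconj J x (z n u) = z n (Jconj J x u).
Proof.
move=> Mx; apply: commutantE; last exact: (Mz n).
exact: (Jconj_commutant hip hM xi_cyclic hJ Mx).
Qed.

Let Jcomm' x n u : M x -> Jconj J x (adj (z n) u) = adj (z n) (Jconj J x u).
Proof. by move=> Mx; have [k ->] := zadj n; exact: Jcomm. Qed.

Let y_xi n : y n xi = z n xi.
Proof. by rewrite /y (Jconj_cyclic hip hM hJ (PM (Pza n))) (adjK hip (bz n)). Qed.

Let z_row : sot_sum (fun n => adj (z n) \o adj (adj (z n))) idfun.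
Proof.
case: hz => _ _ + _; congr sot_sum.
by apply/funext => n; rewrite (adjK hip (bz n)).
Qed.

(** [J], additive and isometric, is applied to the partial sums of [\sum_n z_n z_n^*] at [J v]. *)
Let w_row : sot_sum (fun n => Jconj J (z n) \o adj (Jconj J (z n))) idfun.
Proof.
case: hz => _ + _ _ v => /(_ (J v)) h.
apply/cvg_rnorm => eps eps0; have /cvg_rnorm/(_ _ eps0)[N hN] := h; exists N => n Nn.
have := hN n Nn; rewrite -(rnormJ hJ) (JB hJ) (JK hip hM xi_cyclic hJ) /=.
have JD0 : J 0 = 0 by have := JB hJ 0 0; rewrite subrr => ->; rewrite subrr.
rewrite /series /= (big_morph J (JD hJ) JD0).
under eq_bigr => k _ do rewrite -[J (z k _)]/(J (z k (adj (z k) (J v)))).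
under [in X in _ -> X]eq_bigr => k _ do
  rewrite wadjE /y /Jconj /= (JK hip hM xi_cyclic hJ).
by [].
Qed.

Let z_column : column_isometry z.
Proof.
have := row_column_isometry hip bza z_row.
by have -> : (fun n => adj (adj (z n))) = z by apply/funext => n; rewrite (adjK hip (bz n)).
Qed.

Let y_column : column_isometry y.
Proof.
have := row_column_isometry hip bw w_row.
by have -> : (fun n => adj (Jconj J (z n))) = y by apply/funext => n; rewrite wadjE.
Qed.

(** * An operator fixed by both maps *)

Section FixedPoint.
Context (T : H -> H).
Hypotheses (phiT : fixed_ops (phi_map ip J z) T).
Hypotheses (phi_tildeT : fixed_ops (phi_tilde_map ip z) T).
Let bT : bounded_ops T. Proof. by case: phiT. Qed.

Let hTz : wot_harmonic ip z T.
Proof.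
have := fixed_ops_harmonic hip bza z_row phi_tildeT.
by have -> : (fun n => adj (adj (z n))) = z by apply/funext => n; rewrite (adjK hip (bz n)).
Qed.

Let hTy : wot_harmonic ip y T.
Proof.
have := fixed_ops_harmonic hip bw w_row phiT.
by have -> : (fun n => adj (Jconj J (z n))) = y by apply/funext => n; rewrite wadjE.
Qed.

(** Quantifying over all words makes this kernel stable under each [b m], which only prepends a
    letter; the minimality of [L2 P xi] can then be used. *)
Let kernel_words_closed (b : nat -> H -> H) (D : H -> H) : (forall n, bounded_ops (b n)) ->
  bounded_ops D ->
  closed_subspace [set v | forall w, D (foldl (fun v m => b m v) v w) = 0].
Proof.
move=> bb bD.
have bf w : bounded_ops (fun v => D (foldl (fun v m => b m v) v w)).
  apply: (@bop_comp _ _ D (fun v => foldl (fun v m => b m v) v w)) => //.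
  elim: w => [|m w ih] /=; first exact: bop_id.
  exact: (bop_comp ih (bb m)).
split=> /=.
- by move=> w; rewrite (bop0 (bf w)).
- by move=> c u v hu hv w; rewrite (bopP (bf w)) hu hv scaler0 addr0.
- move=> v hv w; apply: (lipschitz_eq (bop_lipschitz (bf w)) _ _ hv (G := fun=> 0)).
    by exists 0 => // ? ?; rewrite subrr rnorm0 mul0r.
  by move=> a /(_ w).
Qed.

Let commutator_bop b : bounded_ops b -> bounded_ops (commutator b T).
Proof. by move=> bb; apply: bop_sub; exact: bop_comp. Qed.

Let z_comm n v : K v -> z n (T v) = T (z n v).
Proof.
move=> Kv; apply/eqP; rewrite -subr_eq0; apply/eqP.
(* The empty word gives the claim. Commutators with the [z]'s vanish on words in the [y]'s, so
   minimality is invoked for the [y]'s. *)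
suff : [set v | forall w, commutator (z n) T (foldl (fun v m => y m v) v w) = 0] v.
  by move/(_ [::]).
apply: (L2_minimal_Jconj hip hM xi_cyclic hJ hPv PM Pz zadj zgen _ _ _ Kv).
- exact: kernel_words_closed (commutator_bop (bz n)).
- apply: (harmonic_commutator_eq0 hip bz yb bT z_column y_column _ _ _ hTz hTy).
  + by move=> k m u; rewrite /y Jcomm //; exact: PM.
  + by move=> k m u; rewrite /y Jcomm' //; exact: PM.
  + by move=> k; rewrite y_xi.
- by move=> m u hu w; have := hu (m :: w).
Qed.

Let y_comm n v : K v -> y n (T v) = T (y n v).
Proof.
move=> Kv; apply/eqP; rewrite -subr_eq0; apply/eqP.
suff : [set v | forall w, commutator (y n) T (foldl (fun v m => z m v) v w) = 0] v.
  by move/(_ [::]).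
apply: (L2_minimal hip hPv Pz zadj zgen _ _ _ Kv).
- exact: kernel_words_closed (commutator_bop (yb n)).
- apply: (harmonic_commutator_eq0 hip yb bz bT y_column z_column _ _ _ hTy hTz).
  + by move=> k m u; rewrite /y Jcomm //; exact: PM.
  + by move=> k m u; rewrite yadjE Jcomm.
  + by move=> k; rewrite y_xi.
- by move=> m u hu w; have := hu (m :: w).
Qed.

Lemma biharmonic_corner_scalar : exists c, e \o T \o e = c *: e.
Proof.
have be : bounded_ops e by exact: (orth_proj_bop hip hK).
have eK u : K (e u) by exact: (orth_proj_in hip hK).
pose S := e \o T \o e; have bS : bounded_ops S by exact: (bop_comp (bop_comp be bT) be).
have ez n u : e (z n u) = z n (e u).
  apply: (orth_proj_comm hip hK (bz n)) => v Kv.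
    exact: (L2_invariant hPv (Pz n) Kv).
  exact: (L2_invariant hPv (Pza n) Kv).
have ey n u : e (y n u) = y n (e u).
  apply: (orth_proj_comm hip hK (yb n)) => v Kv.
    exact: (L2_Jconj hJ hPv PM (Pza n) Kv).
  by rewrite yadjE; exact: (L2_Jconj hJ hPv PM (Pz n) Kv).
have cS : commutant P S.
  apply: (gen_commutant zgen bS) => n u; rewrite /S /= ez -z_comm //; exact: ez.
have cJS : commutant P (Jconj J S).
  apply: (gen_commutant_Jconj hip hM xi_cyclic hJ hPv Pz zadj zgen bS) => n u.
  by rewrite /S /= -/(y n) ey -y_comm //; exact: ey.
have [||c hc] := corner_central_scalar hip hM xi_cyclic hJ hP PM cS cJS.
- by move=> u; exact: eK.
- by move=> u; rewrite /S /= [e (e u)](orth_proj_idem hip hK).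
by exists c; apply/funext => u; exact: hc.
Qed.
End FixedPoint.

Lemma biharmonic_scale c :
  (fixed_ops (phi_map ip J z) `&` fixed_ops (phi_tilde_map ip z)) (fun u => c *: u).
Proof.
split; first exact: (fixed_ops_scale hip bw w_row).
exact: (fixed_ops_scale hip bza z_row).
Qed.

Lemma biharmonic_corner :
  [set e \o T \o e | T in fixed_ops (phi_map ip J z) `&` fixed_ops (phi_tilde_map ip z)]
  = scalar_multiples e.
Proof.
apply/seteqP; split=> [_ [T [h1 h2] <-]|_ [c _ <-]].
  by have [c ->] := biharmonic_corner_scalar h1 h2; exists c.
exists (fun u => c *: u); first exact: biharmonic_scale.
apply/funext => u /=; rewrite [LHS](bopZ (orth_proj_bop hip hK)).
by congr (_ *: _); exact: (orth_proj_idem hip hK).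
Qed.

End Biharmonic.

Theorem lemma3p7 (R : realType) (H : completeNormedModType R[i])
    (ip : {dot H for (@Num.conj R[i])}) (hip : hilbert_norm ip)
    (M : set (H -> H)) (hM : II1_factor ip M)
    (xi0 : H) (hxi0 : standard_form ip M xi0)
    (J : H -> H) (hJ : modular_conj ip M xi0 J)
    (z : nat -> H -> H) (hz : frakS ip M z)
    (P : set (H -> H)) (hPdef : P = vN_generated ip (range z))
    (hP : is_factor ip P) :
  let e_P := jones_proj ip P xi0 in
  [set e_P \o T \o e_P | T in
     fixed_ops (phi_map ip J z) `&` fixed_ops (phi_tilde_map ip z)]
  = scalar_multiples e_P.
Proof.
case: hM => -[hMv _] _ _; case: hxi0 => _ xi_cyclic _ e_P.
rewrite /e_P hPdef; apply: (biharmonic_corner hip hMv xi_cyclic hJ hz).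
by rewrite -hPdef.
Qed.
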